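(* Let $n\geq 4$, $c\geq 1$, let $M^n$ be a closed smooth connected $n$-manifold, and let $f\in MS(M^n;a,b,c)$ be a Morse-Smale diffeomorphism with no codimension one saddles. Then $a=b=1$, and $M^n$ is a simply connected manifold.
   Context: A diffeomorphism $f:M^n\to M^n$ is Morse-Smale if it is structurally stable and its non-wandering set $NW(f)$ consists of finitely many periodic orbits; in particular, each periodic orbit is hyperbolic, and the stable and unstable manifolds of periodic orbits intersect transversally. For a fixed point $p$, the stable manifold $W^s(p)$ is the set of $x\in M^n$ with $f^{j}(x)\to p$ as $j\to+\infty$, and the unstable manifold $W^u(p)$ is the stable manifold of $p$ for $f^{-1}$; both are called invariant manifolds of $p$. A hyperbolic fixed point $p$ is a sink if $\dim W^s(p)=n$, a source if $\dim W^u(p)=n$, and a saddle if $1\le \dim W^u(p)\le n-1$. A saddle $\sigma$ is a codimension one saddle if $\{\dim W^u(\sigma),\dim W^s(\sigma)\}=\{1,n-1\}$. $MS(M^n;a,b,c)$ denotes the set of Morse-Smale diffeomorphisms $f:M^n\to M^n$ whose non-wandering set consists of fixed points, namely exactly $a$ sinks, $b$ sources and $c$ saddles, and such that the restriction of $f$ to any invariant manifold of every saddle is orientation preserving. *)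

(* Defs.v *)
From HB Require Import structures.
From mathcomp Require Import all_boot all_order all_algebra.
From mathcomp Require Import all_classical all_reals all_analysis.
From mathcomp Require Import complex.

Set Implicit Arguments.
Unset Strict Implicit.
Unset Printing Implicit Defensive.

Import Order.TTheory GRing.Theory Num.Theory.
Import numFieldNormedType.Exports.

Local Open Scope classical_set_scope.
Local Open Scope card_scope.
Local Open Scope ring_scope.

Section Smoothness.
Context {R : realType}.

(* C^k on an open set U of R^m, by recursion on partial derivatives. *)
Fixpoint Ck_on (k m n : nat) (U : set 'rV[R]_m) (F : 'rV[R]_m -> 'rV[R]_n)
    : Prop :=
  match k with
  | 0 => forall x, U x -> {for x, continuous F}
  | k'.+1 => (forall x, U x -> differentiable F x) /\
      forall i : 'I_m, Ck_on k' U (fun x => 'D_(delta_mx 0 i) F x)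
  end.

Definition smooth_on m n (U : set 'rV[R]_m) (F : 'rV[R]_m -> 'rV[R]_n) :=
  forall k, Ck_on k U F.

End Smoothness.

(* Raw chart data; [chart_inv] is only meaningful on the image of the domain. *)
Record chart (R : realType) (M : topologicalType) (n : nat) := Chart {
  chart_dom : set M;
  chart_map :> M -> 'rV[R]_n;
  chart_inv : 'rV[R]_n -> M }.

Section Manifolds.
Context {R : realType}.

Definition is_chart (M : topologicalType) n (phi : chart R M n) :=
  [/\ open (chart_dom phi), open (phi @` chart_dom phi),
      forall x, chart_dom phi x -> chart_inv phi (phi x) = x,
      {within chart_dom phi, continuous phi} &
      {within phi @` chart_dom phi, continuous (chart_inv phi)}].

Definition local_rep (M N : topologicalType) m n
    (phi : chart R M m) (psi : chart R N n) (F : M -> N) :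
    'rV[R]_m -> 'rV[R]_n :=
  fun u => psi (F (chart_inv phi u)).

Definition rep_dom (M N : topologicalType) m n
    (phi : chart R M m) (psi : chart R N n) (F : M -> N) : set 'rV[R]_m :=
  phi @` (chart_dom phi `&` F @^-1` chart_dom psi).

Definition smooth_atlas (M : topologicalType) n (A : set (chart R M n)) :=
  [/\ forall phi, A phi -> is_chart phi,
      forall x, exists2 phi, A phi & chart_dom phi x &
      forall phi psi, A phi -> A psi ->
        smooth_on (rep_dom phi psi id) (local_rep phi psi id)].

Definition closed_smooth_manifold (M : topologicalType) n
    (A : set (chart R M n)) :=
  [/\ hausdorff_space M, @second_countable M, compact [set: M] &
      smooth_atlas A].

Definition euclidean_atlas k : set (chart R 'rV[R]_k k) :=
  [set Chart setT id id].

Definition smooth_map (M N : topologicalType) m n (A : set (chart R M m))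
    (B : set (chart R N n)) (F : M -> N) :=
  continuous F /\
  forall phi psi, A phi -> B psi ->
    smooth_on (rep_dom phi psi F) (local_rep phi psi F).

(* [j] exhibits W as an injectively immersed copy of R^k in M. *)
Definition immersed_copy (M : topologicalType) n (A : set (chart R M n))
    (W : set M) k (j : 'rV[R]_k -> M) :=
  [/\ smooth_map (@euclidean_atlas k) A j,
      forall phi u, A phi -> chart_dom phi (j u) ->
        injective ('d (phi \o j : 'rV[R]_k -> 'rV[R]_n) u),
      injective j & range j = W].

(* Stable and unstable manifolds of hyperbolic fixed points are injectively
   immersed Euclidean spaces; k is their dimension as such. *)
Definition has_dim (M : topologicalType) n (A : set (chart R M n))
    (W : set M) k :=
  exists j : 'rV[R]_k -> M, immersed_copy A W j.

(* F restricts to an orientation preserving self-map of the immersed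
   manifold W: its lift G to the parameter space has positive Jacobian. *)
Definition orientation_preserving_on (M : topologicalType) n
    (A : set (chart R M n)) (F : M -> M) (W : set M) :=
  exists k (j : 'rV[R]_k -> M) (G : 'rV[R]_k -> 'rV[R]_k),
    [/\ immersed_copy A W j,
        smooth_map (@euclidean_atlas k) (@euclidean_atlas k) G,
        forall u, F (j u) = j (G u) &
        forall u, 0 < \det ('J G u)].

End Manifolds.

Record diffeo (R : realType) (M : topologicalType) n (A : set (chart R M n)) :=
  Diffeo {
    diffeo_fun :> M -> M;
    diffeo_inv : M -> M;
    diffeo_smooth : smooth_map A A diffeo_fun;
    diffeo_inv_smooth : smooth_map A A diffeo_inv;
    diffeo_funK : cancel diffeo_fun diffeo_inv;
    diffeo_invK : cancel diffeo_inv diffeo_fun }.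

Section Dynamics.
Context {R : realType} {M : topologicalType} {n : nat} {A : set (chart R M n)}.
Implicit Types (f g : diffeo A) (p x : M).

Definition nonwandering f : set M :=
  [set x | forall U : set M, open U -> U x ->
    exists2 k, (0 < k)%N & (iter k f @` U) `&` U !=set0].

Definition stable_set (F : M -> M) p : set M :=
  [set x | (fun k => iter k F x) @ \oo --> p].

Definition Ws f p : set M := stable_set f p.
Definition Wu f p : set M := stable_set (diffeo_inv f) p.

Definition topologically_conjugate f g :=
  exists h h' : M -> M,
    [/\ continuous h, continuous h', cancel h h', cancel h' h &
        forall x, h (f x) = g (h x)].

(* Neighbourhoods of f in the C^1 topology on smooth diffeomorphisms, from the
   subbasic ones: uniform closeness of values and first derivatives, in charts
   phi and psi, over a compact K inside dom phi with f(K) inside dom psi. *)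
Definition C1_nbhs f (N : set (diffeo A)) :=
  exists (r : nat) (phi psi : 'I_r -> chart R M n) (K : 'I_r -> set M)
         (e : 'I_r -> R),
    (forall i, [/\ A (phi i), A (psi i) & 0 < e i] /\
       [/\ compact (K i), K i `<=` chart_dom (phi i) &
           f @` K i `<=` chart_dom (psi i)]) /\
    forall g,
      (forall i, g @` K i `<=` chart_dom (psi i) /\
         forall u, (phi i @` K i) u ->
           let fi := local_rep (phi i) (psi i) f in
           let gi := local_rep (phi i) (psi i) g in
           `|gi u - fi u| < e i /\ `|'J gi u - 'J fi u| < e i) ->
      N g.

Definition structurally_stable f :=
  exists2 N, C1_nbhs f N & forall g, N g -> topologically_conjugate f g.

Definition morse_smale f :=
  [/\ structurally_stable f, finite_set (nonwandering f) &
      forall x, nonwandering f x -> exists2 k, (0 < k)%N & iter k f x = x].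

Definition hyperbolic_fixed_point f p :=
  f p = p /\
  forall phi, A phi -> chart_dom phi p ->
    forall z : R[i],
      eigenvalue (map_mx (real_complex R)
                    ('J (local_rep phi phi f) (phi p))) z ->
      `|z| != 1.

Definition sink f p := hyperbolic_fixed_point f p /\ has_dim A (Ws f p) n.

Definition source f p := hyperbolic_fixed_point f p /\ has_dim A (Wu f p) n.

Definition saddle f p :=
  hyperbolic_fixed_point f p /\
  exists2 k, has_dim A (Wu f p) k & (1 <= k <= n.-1)%N.

Definition codimension_one_saddle f p :=
  saddle f p /\
  ((has_dim A (Wu f p) 1 /\ has_dim A (Ws f p) n.-1) \/
   (has_dim A (Wu f p) n.-1 /\ has_dim A (Ws f p) 1)).

(* Every fixed point is non-wandering, so the three counts below are counts
   inside the non-wandering set. *)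
Definition MS (a b c : nat) f :=
  [/\ morse_smale f,
      nonwandering f = sink f `|` source f `|` saddle f,
      [/\ sink f #= `I_a, source f #= `I_b & saddle f #= `I_c] &
      forall p, saddle f p ->
        orientation_preserving_on A f (Ws f p) /\
        orientation_preserving_on A f (Wu f p)].

End Dynamics.

Section SimplyConnected.
Context (R : realType) (M : topologicalType).

Let I : set R := `[0, 1].

Definition path_connected :=
  forall x y : M, exists gamma : R -> M,
    [/\ {within I, continuous gamma}, gamma 0 = x & gamma 1 = y].

Definition null_homotopic_loop (gamma : R -> M) :=
  exists H : R * R -> M,
    [/\ {within I `*` I, continuous H},
        forall t, I t -> H (0, t) = gamma t,
        forall t, I t -> H (1, t) = gamma 0 &
        forall s, I s -> H (s, 0) = gamma 0 /\ H (s, 1) = gamma 0].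

Definition simply_connected :=
  path_connected /\
  forall gamma : R -> M, {within I, continuous gamma} -> gamma 0 = gamma 1 ->
    null_homotopic_loop gamma.

End SimplyConnected.

(* Main.v *)
(* At a hyperbolic fixed point p there is a real quadratic form Q which grows
   strictly under the derivative, hence, on differences of nearby points, under
   f itself.  Two points whose forward orbits stay near p therefore differ by a
   vector on which Q is negative, and backward orbits make Q positive.  By
   Baire, an immersed stable (unstable) manifold has a tangent space on which Q
   is negative (positive) definite: the two dimensions add up to at most n, a
   sink attracts a neighbourhood, the stable set of a source is {p}, and an
   accumulation argument shows that the stable set is not {p} as soon as Q takes
   a negative value.  So, without codimension one saddles, the stable and
   unstable manifolds of every saddle have codimension at least 2.

   Each orbit converges to one of the finitely many fixed points, so off a
   countable union W of images of compact pieces of codimension at least 2 the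
   manifold is covered by the open basins of the sinks.  Such pieces are small
   for box counting, and so are the cones over them, of codimension at least 1;
   hence two points of a chart ball off W are joined there by a broken segment
   off W.  Connectedness gives a single sink, and a single source for the
   inverse.  A loop is deformed off W chart by chart, then pushed by an iterate
   of f into a chart ball around the sink and contracted there. *)

Require Import Defs.
From HB Require Import structures.
From mathcomp Require Import all_boot all_order all_algebra.
From mathcomp Require Import all_classical all_reals all_analysis.
From mathcomp Require Import complex spectral.
From mathcomp Require Import ring lra zify.

Set Implicit Arguments.
Unset Strict Implicit.
Unset Printing Implicit Defensive.

Import Order.TTheory GRing.Theory Num.Theory.
Import numFieldNormedType.Exports.

Local Open Scope classical_set_scope.
Local Open Scope ring_scope.

(** * Lyapunov quadratic forms of hyperbolic matrices *)

Section ComplexForms.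
Variable R : realType.
Local Notation C := R[i].

(** The definitions give an invariant manifold as some injectively immersed [R^k] and do not relate
    [k] to the eigenvalues of the derivative. The quadratic form supplies this relation without a
    construction of local invariant manifolds: its inequality concerns differences of two nearby
    orbits, so it can be divided by the square of a parameter increment and passed to the limit
    along any parametrization. Invariant manifolds of saddles are only immersed and may accumulate
    on one another, so the complement of their union need not be open. Smallness is therefore
    measured by counting boxes, which is compatible with closures, Lipschitz images and cones; each
    piece can be closed up, and Baire's theorem handles the countable union. Codimension two is what
    a cone requires: it costs one dimension, and one must remain for the complement of the cone to
    be dense. *)

Definition sqn (z : C) : R := complex.Re z ^+ 2 + complex.Im z ^+ 2.

Lemma sqn_ge0 z : 0 <= sqn z.
Proof. by rewrite addr_ge0 ?sqr_ge0. Qed.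

Lemma sqn0 : sqn 0 = 0.
Proof. by rewrite /sqn /= expr0n addr0. Qed.

Lemma sqnM a b : sqn (a * b) = sqn a * sqn b.
Proof. by case: a => a a'; case: b => b b'; rewrite /sqn /=; ring. Qed.

Lemma sqnD_le a b : sqn (a + b) <= 2 * sqn a + 2 * sqn b.
Proof.
case: a => a a'; case: b => b b'; rewrite /sqn /=.
have := sqr_ge0 (a - b); have := sqr_ge0 (a' - b'); nra.
Qed.

(** Young's inequality [2xy <= e x^2 + y^2 / e] on real and imaginary parts; the sign [s] in the
    proof serves both sides of the absolute value. *)
Lemma sqnD_near (e : R) a b : 0 < e ->
  `|sqn (a + b) - sqn a| <= e * sqn a + (1 + e^-1) * sqn b.
Proof.
move=> e0.
have key (x y : R) : `|(x + y) ^+ 2 - x ^+ 2| <= e * x ^+ 2 + (1 + e^-1) * y ^+ 2.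
  have e1 : e * e^-1 = 1 by rewrite divff // gt_eqF.
  have ei : 0 < e^-1 by rewrite invr_gt0.
  have h (s : R) : s ^+ 2 = 1 -> 2 * s * x * y <= e * x ^+ 2 + e^-1 * y ^+ 2.
    move=> s1; have : 0 <= e * (x - s * e^-1 * y) ^+ 2.
      by rewrite mulr_ge0 ?sqr_ge0 // ltW.
    have -> : e * (x - s * e^-1 * y) ^+ 2 =
      e * x ^+ 2 - 2 * s * x * y * (e * e^-1) + (e * e^-1) * e^-1 * s ^+ 2 * y ^+ 2.
      by ring.
    rewrite e1 s1; lra.
  have h1 := h 1 (expr1n _ _); have h2 := h (-1) (sqrr_sign _ 1).
  have := sqr_ge0 y; rewrite ler_norml => y0; apply/andP; split; lra.
case: a => a a'; case: b => b b'; rewrite /sqn /=.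
have := key a b; have := key a' b'.
rewrite !ler_norml => /andP[? ?] /andP[? ?]; apply/andP; split; lra.
Qed.

Lemma sqn_sum_le n (y : 'I_n -> C) : exists2 D : R, 0 <= D &
  forall x : 'I_n -> C, sqn (\sum_i x i * y i) <= D * \sum_i sqn (x i).
Proof.
elim: n y => [|n IH] y.
  by exists 0 => // x; rewrite big_ord0 sqn0 mul0r.
have [D D0 HD] := IH (fun i => y (lift ord0 i)).
exists (2 * sqn (y ord0) + 2 * D).
  by rewrite addr_ge0 ?mulr_ge0 ?sqn_ge0.
move=> x; rewrite !big_ord_recl.
apply: le_trans (sqnD_le _ _) _; rewrite sqnM.
have := HD (fun i => x (lift ord0 i)).
have := sqn_ge0 (x ord0); have := sqn_ge0 (y ord0).
have : 0 <= \sum_(i < n) sqn (x (lift ord0 i)) by apply: sumr_ge0 => i _; apply: sqn_ge0.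
set S := \sum_(i < n) _; nra.
Qed.

(** [s] is the sign of [|a|^2 - 1], and [b] stands for the contribution of the other coordinates of
    a triangular matrix. In both cases [e] lets Young's inequality consume at most half of the gap
    between [|a|^2] and 1. *)
Lemma scalar_hyperbolic (a : C) : sqn a != 1 -> exists (s k F : R),
  [/\ 0 < k, 0 <= F & forall x b,
    k * sqn x - F * sqn b <= s * (sqn (x * a + b) - sqn x)].
Proof.
move=> a1; have t0 := sqn_ge0 a; set t := sqn a in a1 t0 *.
have [t1|t1|] := ltgtP t 1; last by move/eqP; rewrite (negbTE a1).
- pose e := (1 - t) / 2; have e0 : 0 < e by rewrite /e; lra.
  exists (-1), ((1 - t) / 2), (1 + e^-1); split; first by lra.
    by rewrite addr_ge0 // invr_ge0 ltW.
  move=> x b; have := sqnD_near (x * a) b e0.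
  rewrite sqnM -/t ler_norml => /andP[_ h].
  have := sqn_ge0 x; set X := sqn x in h *; set B := (1 + _) * _ in h *.
  move=> X0; have : 0 <= X * (1 - t) ^+ 2 by rewrite mulr_ge0 ?sqr_ge0.
  have : e * (X * t) = (1 - t) / 2 * (X * t) by [].
  lra.
- pose e := (t - 1) / (2 * t); have e0 : 0 < e.
    by rewrite divr_gt0 ?mulr_gt0 //; lra.
  have et : e * t = (t - 1) / 2.
    by rewrite /e; field; rewrite gt_eqF //; lra.
  exists 1, ((t - 1) / 2), (1 + e^-1); split; first by lra.
    by rewrite addr_ge0 // invr_ge0 ltW.
  move=> x b; have := sqnD_near (x * a) b e0.
  rewrite sqnM -/t ler_norml => /andP[h _].
  have := sqn_ge0 x; set X := sqn x in h *; set B := (1 + _) * _ in h *.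
  have : e * (X * t) = (t - 1) / 2 * X by rewrite -et; ring.
  lra.
Qed.

(** For row vectors, coordinate [j] of the image depends only on the coordinates [i >= j]. Removing
    index 0 leaves an autonomous block, treated by induction, and a scalar driven by that block. *)
Lemma triangular_lyapunov n (T : 'I_n -> 'I_n -> C) :
  (forall i j : 'I_n, (i < j)%N -> T i j = 0) -> (forall i, sqn (T i i) != 1) ->
  exists (d : 'I_n -> R) (c : R), 0 < c /\ forall w : 'I_n -> C,
    c * \sum_j sqn (w j) <=
    \sum_j d j * (sqn (\sum_i w i * T i j) - sqn (w j)).
Proof.
elim: n T => [|n IH] T T0 T1.
  by exists (fun _ => 0), 1; split=> // w; rewrite !big_ord0 mulr0.
have [||d [c [c0 Hd]]] := IH (fun i j => T (lift ord0 i) (lift ord0 j)).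
- by move=> i j ij; apply: T0.
- by move=> i; apply: T1.
have [s [k [F [k0 F0 Hs]]]] := scalar_hyperbolic (T1 ord0).
have [D D0 HD] := sqn_sum_le (fun i => T (lift ord0 i) ord0).
(* With this weight the coercivity [K * c] of the block absorbs the cross term [F * D] and leaves
   1. *)
pose K := (F * D + 1) / c.
have Kc : K * c = F * D + 1 by rewrite /K divfK // gt_eqF.
exists (fun j => if unlift ord0 j is Some j' then K * d j' else s), (Num.min k 1).
split; first by rewrite lt_min k0 ltr01.
move=> w; rewrite !big_ord_recl unlift_none.
set X := sqn (w ord0); set Y := \sum_(i < n) sqn (w _).
have X0 : 0 <= X := sqn_ge0 _.
have Y0 : 0 <= Y by apply: sumr_ge0 => i _; apply: sqn_ge0.
set S1 := s * _; set S2 := \sum_(j < n) _.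
have h1 : k * X - F * (D * Y) <= S1.
  apply: le_trans (Hs (w ord0) (\sum_(i < n) w (lift ord0 i) * T (lift ord0 i) ord0)).
  by rewrite lerB // ler_wpM2l // HD.
have h2 : K * (c * Y) <= S2.
  have -> : S2 = K * \sum_j d j * (sqn (\sum_i w (lift ord0 i) *
      T (lift ord0 i) (lift ord0 j)) - sqn (w (lift ord0 j))).
    rewrite mulr_sumr; apply: eq_bigr => j _; rewrite liftK mulrA; congr (_ * (sqn _ - _)).
    by rewrite big_ord_recl T0 ?mulr0 ?add0r.
  rewrite ler_wpM2l ?Hd // divr_ge0 ?(ltW c0) // addr_ge0 // mulr_ge0 //.
rewrite mulrA Kc in h2.
have m1 : Num.min k 1 <= k by rewrite ge_min lexx.
have m2 : Num.min k 1 <= 1 by rewrite ge_min lexx orbT.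
have := ler_wpM2r X0 m1; have := ler_wpM2r Y0 m2; lra.
Qed.

End ComplexForms.
Section QuadraticForms.
Variable R : realType.

Definition bform m n (H : 'M[R]_(m, n)) (u : 'rV[R]_m) (v : 'rV[R]_n) : R :=
  (u *m H *m v^T) 0 0.
Definition qform n (H : 'M[R]_n) (v : 'rV[R]_n) : R := bform H v v.

Lemma coord_le_norm m n (x : 'M[R]_(m, n)) i j : `|x i j| <= `|x|.
Proof. by rewrite [leRHS]mx_normrE; apply: (le_bigmax _ (fun p => `|x p.1 p.2|) (i, j)). Qed.

Lemma norm_le_coord m n (x : 'M[R]_(m, n)) (r : R) : 0 <= r ->
  (forall i j, `|x i j| <= r) -> `|x| <= r.
Proof.
by move=> r0 h; rewrite [leLHS]mx_normrE; apply/bigmax_leP; split=> // -[i j] _; apply: h.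
Qed.

Lemma bform_bound m n (H : 'M[R]_(m, n)) : exists2 B : R, 0 < B &
  forall u v, `|bform H u v| <= B * `|u| * `|v|.
Proof.
exists (1 + \sum_i \sum_j `|H j i|).
  by rewrite ltr_pwDl // sumr_ge0 // => i _; apply: sumr_ge0.
move=> u v; rewrite /bform mxE.
apply: (@le_trans _ _ ((\sum_i \sum_j `|H j i|) * `|u| * `|v|)); last first.
  by rewrite !ler_wpM2r // lerDr.
rewrite !mulr_suml; apply: le_trans (ler_norm_sum _ _ _) _; apply: ler_sum => i _.
rewrite !mxE normrM ler_pM //; last exact: coord_le_norm.
rewrite mulr_suml; apply: le_trans (ler_norm_sum _ _ _) _; apply: ler_sum => j _.
by rewrite normrM mulrC ler_wpM2l // coord_le_norm.
Qed.

Lemma bformDl m n (H : 'M[R]_(m, n)) u u' v :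
  bform H (u + u') v = bform H u v + bform H u' v.
Proof. by rewrite /bform !mulmxDl mxE. Qed.

Lemma bformDr m n (H : 'M[R]_(m, n)) u v v' :
  bform H u (v + v') = bform H u v + bform H u v'.
Proof. by rewrite /bform linearD /= mulmxDr mxE. Qed.

Lemma qformZ n (H : 'M[R]_n) (t : R) v : qform H (t *: v) = t ^+ 2 * qform H v.
Proof. by rewrite /qform /bform linearZ /= -!scalemxAl -scalemxAr !mxE; ring. Qed.

Lemma qformN n (H : 'M[R]_n) v : qform (- H) v = - qform H v.
Proof. by rewrite /qform /bform mulmxN mulNmx mxE. Qed.

Lemma qform_near n (H : 'M[R]_n) : exists2 B : R, 0 < B &
  (forall v, `|qform H v| <= B * `|v| ^+ 2) /\
  forall v e, `|qform H (v + e) - qform H v| <= B * (2 * `|v| + `|e|) * `|e|.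
Proof.
have [B B0 HB] := bform_bound H; exists B => //; split=> [v|v e].
  by rewrite expr2 mulrA; apply: HB.
have -> : qform H (v + e) - qform H v = bform H v e + bform H e v + bform H e e.
  by rewrite /qform bformDl !bformDr; ring.
apply: le_trans (ler_normD _ _) _; apply: le_trans (lerD (ler_normD _ _) (lexx _)) _.
have := HB v e; have := HB e v; have := HB e e; lra.
Qed.

Lemma sqn_complexify n (v : 'rV[R]_n) (B : 'M[R[i]]_n) i :
  sqn ((map_mx (real_complex R) v *m B) 0 i) =
  (v *m map_mx (@complex.Re R) B) 0 i ^+ 2 + (v *m map_mx (@complex.Im R) B) 0 i ^+ 2.
Proof.
rewrite /sqn !mxE; congr (_ ^+ 2 + _ ^+ 2).
- rewrite (@big_morph _ _ (@complex.Re R) 0 +%R) //; last by case=> ? ? [].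
  by apply: eq_bigr => j _; rewrite !mxE; case: (B j i) => ? ? /=; ring.
- rewrite (@big_morph _ _ (@complex.Im R) 0 +%R) //; last by case=> ? ? [].
  by apply: eq_bigr => j _; rewrite !mxE; case: (B j i) => ? ? /=; ring.
Qed.

Lemma qform_diag n (B : 'M[R]_n) (d : 'I_n -> R) v :
  qform (B *m diag_mx (\row_i d i) *m B^T) v = \sum_i d i * (v *m B) 0 i ^+ 2.
Proof.
rewrite /qform /bform !mulmxA -mulmxA -trmx_mul mxE; apply: eq_bigr => i _.
rewrite -!mulmxA mulmxA mul_mx_diag !mxE; ring.
Qed.

(* The diagonal form carries the sign of [|t_ii| - 1] in a basis where the
   matrix is lower triangular, with rapidly growing weights. *)
Lemma hyperbolic_lyapunov n (A : 'M[R]_n) :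
  (forall z : R[i], eigenvalue (map_mx (real_complex R) A) z -> `|z| != 1) ->
  exists (H : 'M[R]_n) (c : R), 0 < c /\
    forall v, qform H v + c * `|v| ^+ 2 <= qform H (v *m A).
Proof.
case: n A => [|n] A hypA.
  exists 0, 1; split=> // v; rewrite (_ : v = 0); last by apply/rowP; case.
  by rewrite mul0mx normr0 expr0n /= mulr0 addr0.
set AC := map_mx _ A in hypA.
have [P /unitarymx_unit Pu] := @Schur _ _ AC isT.
rewrite /similar_to /= conjumx //; set T := P *m AC *m invmx P => trigT.
have T1 i : sqn (T i i) != 1.
  have eigT : eigenvalue T (T i i).
    rewrite eigenvalue_root_char char_poly_trig // /root horner_prod.
    by apply/prodf_eq0; exists i; rewrite // hornerXsubC subrr.
  have /hypA : eigenvalue AC (T i i).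
    have /eigenvalueP[w wT w0] := eigT; apply/eigenvalueP; exists (w *m P).
      by rewrite scalemxAl -wT /T !mulmxA mulmxKV.
    by apply: contraNneq w0 => wP; rewrite -[w](mulmxK Pu) wP mul0mx.
  apply: contraNneq => s1; rewrite normc_def -/(sqn _).
  have := s1; rewrite /sqn => ->; rewrite sqrtr1; exact/eqP.
have [|d [c [c0 Hd]]] := triangular_lyapunov (T := fun i j => T i j) _ T1.
  by move=> i j ij; move/is_trig_mxP: trigT; apply.
pose B := invmx P.
(* The Schur basis is complex, but on real vectors the form [sum d_i |(v B)_i|^2] splits into real
   and imaginary parts and is given by this real matrix. *)
pose H := map_mx (@complex.Re R) B *m diag_mx (\row_i d i) *m (map_mx (@complex.Re R) B)^T +
          map_mx (@complex.Im R) B *m diag_mx (\row_i d i) *m (map_mx (@complex.Im R) B)^T.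
have HE v : qform H v = \sum_i d i * sqn ((map_mx (real_complex R) v *m B) 0 i).
  pose S h := map_mx h B *m diag_mx (\row_i d i) *m (map_mx h B)^T.
  have -> : qform H v = qform (S (@complex.Re R)) v + qform (S (@complex.Im R)) v.
    by rewrite /qform /bform mulmxDr mulmxDl [LHS]mxE.
  by rewrite !qform_diag -big_split; apply: eq_bigr => i _; rewrite sqn_complexify mulrDr.
have [D D0 HD] : exists2 D : R, 0 < D & forall v : 'rV[R]_n.+1,
    `|v| ^+ 2 <= D * \sum_i sqn ((map_mx (real_complex R) v *m B) 0 i).
  have /choice[D HD] : forall j : 'I_n.+1, exists D : R, 0 <= D /\ forall x : 'I_n.+1 -> R[i],
      sqn (\sum_i x i * P i j) <= D * \sum_i sqn (x i).
    by move=> j; have [D D0 HD] := sqn_sum_le (fun i => P i j); exists D.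
  exists (1 + \sum_j D j).
    by rewrite ltr_pwDl // sumr_ge0 // => j _; have [] := HD j.
  move=> v; set S := \sum_i sqn _.
  have S0 : 0 <= S by apply: sumr_ge0 => i _; apply: sqn_ge0.
  have hD0 : 0 <= \sum_j D j by apply: sumr_ge0 => j _; have [] := HD j.
  have key j : `|v 0 j| ^+ 2 <= (1 + \sum_j D j) * S.
    have -> : `|v 0 j| ^+ 2 = sqn ((map_mx (real_complex R) v *m B *m P) 0 j).
      by rewrite mulmxKV // mxE /sqn /= expr0n addr0 real_normK ?num_real.
    rewrite mxE; have [_ h] := HD j.
    apply: le_trans (h (fun i => (map_mx (real_complex R) v *m B) 0 i)) _.
    rewrite ler_wpM2r // (bigD1 j) //= addrCA lerDl addr_ge0 //.
    by apply: sumr_ge0 => k _; have [] := HD k.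
  have [v0|v0] := eqVneq `|v| 0.
    by rewrite v0 expr0n /= mulr_ge0 // addr_ge0.
  have [[i j] /= vij] := mx_norm_neq0 v0.
  by have := key j; rewrite -(ord1 i) -vij.
exists H, (c / D); split; first by rewrite divr_gt0.
move=> v; rewrite !HE map_mxM -/AC.
pose w i := (map_mx (real_complex R) v *m B) 0 i.
have wT i : (map_mx (real_complex R) v *m AC *m B) 0 i = \sum_k w k * T k i.
  have -> : map_mx (real_complex R) v *m AC *m B = map_mx (real_complex R) v *m B *m T.
    by rewrite /T !mulmxA mulmxKV.
  by rewrite mxE.
under [X in _ <= X]eq_bigr do rewrite wT.
rewrite addrC -lerBrDr -sumrB.
under [X in _ <= X]eq_bigr do rewrite -mulrBr.
apply: le_trans (Hd w); rewrite mulrAC ler_pdivrMr // -mulrA ler_wpM2l ?(ltW c0) // mulrC.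
exact: HD.
Qed.

End QuadraticForms.
(** * Strict differentiability *)

Section StrictDerivative.
Variable R : realType.

Lemma is_derive_line m n (F : 'rV[R]_m -> 'rV[R]_n) z v (t : R) j :
  differentiable F (t *: v + z) ->
  is_derive t 1 (fun s : R => F (s *: v + z) 0 j) ((v *m 'J F (t *: v + z)) 0 j).
Proof.
move=> dF; have dv : derivable F (t *: v + z) v by exact: diff_derivable.
have ev := deriveEjacobian v dF.
have cvgF : (fun h : R => h^-1 *: ((F \o shift (t *: v + z)) (h *: v) - F (t *: v + z)))
    @ 0^' --> v *m 'J F (t *: v + z) by rewrite -ev; exact: dv.
have /(_ _) cvgj := @cvg_comp _ _ _ _ (fun M : 'rV[R]_n => M 0 j) _ _ _ cvgF
  (@coord_continuous _ 1 n 0 j _).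
have {}cvgj : (fun h : R => h^-1 *: (((fun s : R => F (s *: v + z) 0 j) \o shift t) (h *: (1 : R)) -
    F (t *: v + z) 0 j)) @ 0^' --> (v *m 'J F (t *: v + z)) 0 j.
  apply: cvg_trans cvgj; apply: near_eq_cvg; near=> h => /=.
  rewrite !mxE /=; congr (_ * (F _ 0 j - _)).
  by rewrite [h *: 1]mulr1 scalerDl addrA.
split; first by apply/cvg_ex; exists ((v *m 'J F (t *: v + z)) 0 j).
exact: cvg_lim cvgj.
Unshelve. all: by end_near.
Qed.

(** The intermediate point depends on the coordinate [j]: vector-valued maps have no common one. *)
Lemma mean_value_coord m n (F : 'rV[R]_m -> 'rV[R]_n) y z j :
  (forall t : R, 0 <= t <= 1 -> differentiable F (t *: (y - z) + z)) ->
  exists2 t : R, 0 <= t <= 1 &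
    F y 0 j - F z 0 j = ((y - z) *m 'J F (t *: (y - z) + z)) 0 j.
Proof.
move=> dF; pose g t : R := F (t *: (y - z) + z) 0 j.
have dg (t : R) : 0 <= t <= 1 -> is_derive t 1 g (((y - z) *m 'J F (t *: (y - z) + z)) 0 j).
  by move=> /dF; apply: is_derive_line.
have [||t] := @MVT R g (fun t : R => ((y - z) *m 'J F (t *: (y - z) + z)) 0 j) 0 1 ltr01.
- by move=> t; rewrite in_itv /= => /andP[t0 t1]; apply: dg; rewrite !ltW.
- apply: continuous_in_subspaceT => t; rewrite inE /= in_itv /= => /dg dt.
  by apply: differentiable_continuous; apply/derivable1_diffP; case: dt.
rewrite in_itv /= subr0 mulr1 /g scale1r scale0r add0r subrK => /andP[t0 t1] e.
by exists t => //; rewrite !ltW.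
Qed.

Lemma row_jacobian m n i j (F : 'rV[R]_m -> 'rV[R]_n) w : differentiable F w ->
  'J F w i j = ('D_(delta_mx 0 i) F w) 0 j.
Proof. by move=> dF; rewrite deriveEjacobian // -rowE [RHS]mxE. Qed.

Lemma norm_mulmx_le m n (v : 'rV[R]_m) (J : 'M[R]_(m, n)) (e : R) :
  (forall i j, `|J i j| <= e) -> 0 <= e -> `|v *m J| <= m%:R * e * `|v|.
Proof.
move=> Je e0; apply: norm_le_coord => [|i j]; first by rewrite !mulr_ge0.
rewrite ord1 mxE; apply: le_trans (ler_norm_sum _ _ _) _.
have -> : m%:R * e * `|v| = \sum_(i < m) (e * `|v|).
  by rewrite sumr_const card_ord -mulrA mulr_natl.
apply: ler_sum => k _.
by rewrite normrM mulrC ler_pM // coord_le_norm.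
Qed.

Lemma coordB3 n (a b d : 'rV[R]_n) j : (a - b - d) 0 j = a 0 j - b 0 j - d 0 j.
Proof. by rewrite !mxE. Qed.

Lemma coordB m n (P Q : 'M[R]_(m, n)) i j : (P - Q) i j = P i j - Q i j.
Proof. by rewrite !mxE. Qed.

Lemma coord_mulmxBr m n (v : 'rV[R]_m) (P Q : 'M[R]_(m, n)) j :
  (v *m (P - Q)) 0 j = (v *m P) 0 j - (v *m Q) 0 j.
Proof. by rewrite mulmxBr !mxE. Qed.

Lemma ball_convex n (a : 'rV[R]_n) (r : R) y z (t : R) : 0 <= t <= 1 ->
  ball a r y -> ball a r z -> ball a r (y + t *: (z - y)).
Proof.
rewrite -!ball_normE /= => /andP[t0 t1] ya za.
have -> : a - (y + t *: (z - y)) = (1 - t) *: (a - y) + t *: (a - z).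
  by apply/rowP => j; rewrite !mxE; ring.
have t1' : 0 <= 1 - t by rewrite subr_ge0.
apply: le_lt_trans (ler_normD _ _) _; rewrite !normrZ (ger0_norm t0) (ger0_norm t1').
apply: (@le_lt_trans _ _ (Num.max `|a - y| `|a - z|)); last by rewrite gt_max ya za.
have h1 : `|a - y| <= Num.max `|a - y| `|a - z| by rewrite le_max lexx.
have h2 : `|a - z| <= Num.max `|a - y| `|a - z| by rewrite le_max lexx orbT.
have := ler_wpM2l t1' h1; have := ler_wpM2l t0 h2; lra.
Qed.

(** Both points vary, which is more than differentiability at [x] and is what differences of orbits
    require. Along the segment between them the Jacobian stays close to its value at [x], by
    continuity of the partial derivatives. *)
Lemma strict_derivative m n (U : set 'rV[R]_m) (F : 'rV[R]_m -> 'rV[R]_n) x (e : R) :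
  open U -> U x -> smooth_on U F -> 0 < e ->
  exists2 r : R, 0 < r & ball x r `<=` U /\ forall y z, ball x r y -> ball x r z ->
    `|F y - F z - (y - z) *m 'J F x| <= e * `|y - z|.
Proof.
move=> oU Ux smF e0; have [dF cdF] := smF 1%N.
(* Multiplying by a matrix with [m] rows costs a factor [m] in the sup norm; the successor covers
   [m = 0]. *)
pose e' := e / m.+1%:R; have e'0 : 0 < e' by rewrite divr_gt0.
have nearJ : \forall w \near x, U w /\ forall i j, `|'J F w i j - 'J F x i j| <= e'.
  near=> w; have Uw : U w by near: w; apply: open_nbhs_nbhs.
  split; first exact: Uw.
  move=> i j.
  have -> : 'J F w i j - 'J F x i j = ('D_(delta_mx 0 i) F w) 0 j - ('D_(delta_mx 0 i) F x) 0 j.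
    apply: (f_equal2 (fun a b : R => a - b)).
      exact: (row_jacobian i j (dF w Uw)).
    exact: (row_jacobian i j (dF x Ux)).
  have : `|'D_(delta_mx 0 i) F x - 'D_(delta_mx 0 i) F w| < e'.
    move: i {j}; near: w; apply: filter_forall => i.
    have c : ('D_(delta_mx 0 i) F) @ x --> 'D_(delta_mx 0 i) F x := cdF i x Ux.
    by move/cvgrPdist_lt: c => /(_ e' e'0).
  move=> /ltW; apply: le_trans.
  by have := coord_le_norm ('D_(delta_mx 0 i) F x - 'D_(delta_mx 0 i) F w) 0 j; rewrite !mxE distrC.
have [r /= r0 Hr] := (nbhs_ballP _ _).1 nearJ; exists r => //.
split=> [w /Hr []//|y z ry rz].
have seg (t : R) : 0 <= t <= 1 -> ball x r (t *: (y - z) + z).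
  by move=> t01; rewrite addrC; exact: ball_convex.
apply: norm_le_coord => [|i j]; first by rewrite mulr_ge0 // ltW.
rewrite ord1.
have [t t01 Ft] := @mean_value_coord m n F y z j (fun (t : R) t01 => dF _ (Hr _ (seg t t01)).1).
have [_ HJ] := Hr _ (seg t t01).
have -> : (F y - F z - (y - z) *m 'J F x) 0 j =
    ((y - z) *m ('J F (t *: (y - z) + z) - 'J F x)) 0 j.
  apply: etrans (coordB3 _ _ _ _) _; apply: etrans (esym (coord_mulmxBr _ _ _ _)).
  exact: (f_equal (fun s : R => s - _) Ft).
apply: le_trans (coord_le_norm _ _ _) _.
apply: le_trans (norm_mulmx_le _ (e := e') _ (ltW e'0)) _ => [i' j'|].
  by rewrite coordB; apply: HJ.
rewrite ler_wpM2r // /e' mulrCA ger_pMr // ler_pdivrMr // mul1r ler_nat //.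
Unshelve. all: by end_near.
Qed.

Lemma norm_mulmx_bound m n (J : 'M[R]_(m, n)) : exists2 B : R, 0 < B &
  forall v : 'rV[R]_m, `|v *m J| <= B * `|v|.
Proof.
exists (m%:R * `|J| + 1) => [|v]; first by rewrite ltr_wpDl // mulr_ge0.
apply: le_trans (norm_mulmx_le _ (e := `|J|) _ _) _ => //; first exact: coord_le_norm.
by rewrite ler_wpM2r // lerDl.
Qed.

Lemma locally_lipschitz m n (U : set 'rV[R]_m) (F : 'rV[R]_m -> 'rV[R]_n) x :
  open U -> U x -> smooth_on U F ->
  exists r L : R, [/\ 0 < r, 0 < L, ball x r `<=` U & forall y z,
    ball x r y -> ball x r z -> `|F y - F z| <= L * `|y - z|].
Proof.
move=> oU Ux smF; have [r r0 [rU Hr]] := strict_derivative oU Ux smF ltr01.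
have [B B0 HB] := norm_mulmx_bound ('J F x).
exists r, (1 + B); split=> //; first by rewrite addr_gt0.
move=> y z ry rz; rewrite -[F y - F z](subrK ((y - z) *m 'J F x)) mulrDl.
by apply: le_trans (ler_normD _ _) _; rewrite lerD ?Hr.
Qed.

End StrictDerivative.
(** * Box dimension and thin sets *)

Section BoxDimension.
Variable R : realType.

(** Upper box dimension at most [m], with one constant for all scales. Scale 1 is included, so such
    sets are bounded. Centres may lie outside [S], so the notion passes to subsets at once. *)
Definition box_dim_le n (m : nat) (S : set 'rV[R]_n) :=
  exists C : nat, forall K : nat, exists2 s : seq 'rV[R]_n,
    (size s <= C * K.+1 ^ m)%N &
    forall x, S x -> exists2 y, y \in s & `|x - y| <= K.+1%:R^-1.

Lemma box_dim_le_empty n m : box_dim_le m (set0 : set 'rV[R]_n).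
Proof. by exists 0%N => K; exists [::]. Qed.

Lemma box_dim_le_sub n m (S T : set 'rV[R]_n) : S `<=` T -> box_dim_le m T -> box_dim_le m S.
Proof.
move=> ST [C HC]; exists C => K; have [s sz Hs] := HC K.
by exists s => // x /ST; apply: Hs.
Qed.

Lemma box_dim_le_bounded n m (S : set 'rV[R]_n) : box_dim_le m S ->
  exists B : nat, forall x, S x -> `|x| <= B%:R.
Proof.
move=> [C /(_ 0%N)[s _ Hs]].
have [B HB] : exists B : R, forall y, y \in s -> `|y| <= B.
  elim: s {Hs} => [|a s [B HB]]; first by exists 0.
  exists (Num.max `|a| B) => y; rewrite inE => /orP[/eqP->|/HB yB].
    by rewrite le_max lexx.
  by rewrite le_max yB orbT.
exists (Num.bound (B + 1)) => x /Hs[y ys xy].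
apply: ltW; apply: le_lt_trans (unstable.ltr_bound _).
rewrite -[x](subrK y) addrC; apply: le_trans (ler_normD _ _) _.
by rewrite lerD ?HB // (le_trans xy) // invr1.
Qed.

Lemma box_dim_le_closure n m (S : set 'rV[R]_n) : box_dim_le m S -> box_dim_le m (closure S).
Proof.
move=> [C HC]; exists (C * 2 ^ m)%N => K.
(* Scales are counted by successors, and [(2 * K + 1).+1] is twice [K.+1]: half of the tolerance is
   spent on replacing a point of the closure by one of [S]. *)
have [s sz Hs] := HC (2 * K + 1)%N.
have eK : (2 * K + 1).+1 = (2 * K.+1)%N by lia.
rewrite eK in sz Hs; exists s; first by rewrite -mulnA -expnMn.
move=> x clx; have K0 : 0 < (2 * K.+1)%:R^-1 :> R by rewrite invr_gt0 ltr0n.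
have [z [Sz bz]] := clx _ (nbhsx_ballx x _ K0).
have [y ys zy] := Hs z Sz; exists y => //.
rewrite -(subrK z x) -addrA; apply: le_trans (ler_normD _ _) _.
have e2 : K.+1%:R^-1 = (2 * K.+1)%:R^-1 + (2 * K.+1)%:R^-1 :> R.
  by rewrite natrM; field; rewrite nat1r pnatr_eq0.
rewrite e2 lerD //; move: bz; rewrite -ball_normE /= => /ltW; exact.
Qed.

(** Pigeonhole: a grid of [N^n] points with spacing [r / (2N)] fits in the ball. At scale
    [1 / (N D)], where [D r > 4], no centre serves two grid points, so [N^n <= C (N D)^m]; this
    fails for [N = C D^m + 1]. *)
Lemma box_dim_le_no_ball n m (S : set 'rV[R]_n) x (r : R) : (m < n)%N -> 0 < r ->
  box_dim_le m S -> ~ (ball x r `<=` S).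
Proof.
move=> mn r0 [C HC] xrS.
pose D := (Num.bound (4 / r)).+1.
have D4 : 4 < D%:R * r.
  rewrite -ltr_pdivrMr // (lt_trans (unstable.ltr_bound _)) // ltr_nat //.
pose N := (C * D ^ m).+1.
have [s sz Hs] := HC (N * D).-1.
have ND0 : (0 < N * D)%N by rewrite muln_gt0.
rewrite prednK // in sz Hs.
pose g (i : {ffun 'I_n -> 'I_N}) : 'rV[R]_n := \row_k (x 0 k + (i k)%:R * (r / (2 * N%:R))).
have N0 : 0 < N%:R :> R by rewrite ltr0n.
have gb i : ball x r (g i).
  rewrite -ball_normE /=; apply: (@le_lt_trans _ _ (r / 2)); last lra.
  apply: norm_le_coord => [|a k]; first lra.
  rewrite ord1 !mxE opprD addNKr normrN ger0_norm; last first.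
    by rewrite mulr_ge0 // divr_ge0 ?(ltW r0) // mulr_ge0.
  rewrite mulrCA ler_wpM2l ?(ltW r0) // ler_pdivrMr ?mulr_gt0 //.
  by rewrite mulrA mulVf // mul1r ler_nat ltnW.
have /choice[h Hh] : forall i, exists y, y \in s /\ `|g i - y| <= (N * D)%:R^-1.
  by move=> i; have [y ys yi] := Hs _ (xrS _ (gb i)); exists y.
have idx i : (index (h i) s < size s)%N by rewrite index_mem; have [] := Hh i.
pose f i : 'I_(size s) := Ordinal (idx i).
have finj : injective f.
  move=> i i' /(congr1 val) /= e.
  have hE : h i = h i'.
    have [hi _] := Hh i; have [hi' _] := Hh i'.
    by rewrite -(nth_index 0 hi) e nth_index.
  have [_ d1] := Hh i; have [_ d2] := Hh i'; rewrite hE in d1.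
  apply/ffunP => k; apply/val_inj/eqP; rewrite -(eqr_nat R) -subr_eq0 -normr_le0.
  rewrite leNgt; apply/negP => pos.
  have ge1 : 1 <= `|(i k)%:R - (i' k)%:R| :> R.
    move: pos; rewrite normr_gt0 subr_eq0 eqr_nat => ne.
    have [lt|lt|e'] := ltngtP (i k : nat) (i' k); last by case/eqP: ne.
      by rewrite distrC -natrB 1?ltnW // normr_nat ler1n subn_gt0.
    by rewrite -natrB 1?ltnW // normr_nat ler1n subn_gt0.
  have : `|g i - g i'| <= 2 * (N * D)%:R^-1.
    rewrite -[g i - g i'](subrKA (h i')); apply: le_trans (ler_normD _ _) _.
    by rewrite mulr_natl mulr2n lerD // distrC.
  move/(le_trans (coord_le_norm _ 0 k)); rewrite !mxE opprD addrACA subrr add0r -mulrBl normrM.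
  rewrite [`|r / _|]ger0_norm; last by rewrite divr_ge0 ?(ltW r0) // mulr_ge0.
  rewrite leNgt => /negP; apply; apply: (@lt_le_trans _ _ (r / (2 * N%:R))); last first.
    by rewrite ler_peMl // divr_ge0 ?(ltW r0) // mulr_ge0.
  rewrite natrM invfM mulrA ltr_pdivrMr; last by rewrite ltr0n.
  rewrite ltr_pdivrMr //.
  have -> : r / (2 * N%:R) * D%:R * N%:R = D%:R * r / 2 by field; rewrite gt_eqF.
  lra.
have := leq_card f finj; rewrite card_ffun !card_ord => le1.
have := leq_trans le1 sz; apply/negP; rewrite -ltnNge.
have -> : (C * (N * D) ^ m = (C * D ^ m) * N ^ m)%N by rewrite expnMn; lia.
apply: (@leq_trans (N ^ m.+1)%N); last by rewrite leq_pexp2l.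
by rewrite expnS ltn_pmul2r ?expn_gt0.
Qed.

Lemma box_dim_le_ball n x (r : R) : box_dim_le n (ball (x : 'rV[R]_n) r).
Proof.
pose B := (Num.bound r).+1.
exists ((2 * B + 1) ^ n)%N => K.
pose T := {ffun 'I_n -> 'I_(2 * B * K.+1 + 1)}.
pose g (i : T) : 'rV[R]_n := \row_k (x 0 k - B%:R + (i k)%:R / K.+1%:R).
exists [seq g i | i <- enum T].
  rewrite size_map -cardE card_ffun !card_ord -expnMn; case: (n) => // n'.
  by rewrite leq_exp2r //; nia.
move=> y; rewrite -ball_normE /= => xy.
have yk k : 0 <= (y 0 k - x 0 k + B%:R) * K.+1%:R < (2 * B * K.+1 + 1)%:R.
  have := le_lt_trans (coord_le_norm _ 0 k) xy; rewrite !mxE => xyk.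
  have : `|x 0 k - y 0 k| < B%:R.
    apply: lt_trans xyk _; apply: lt_trans (unstable.ltr_bound _) _; rewrite ltr_nat //.
  rewrite ltr_norml => /andP[h1 h2]; apply/andP; split.
    by rewrite mulr_ge0 //; lra.
  rewrite natrD natrM; apply: ltr_wpDr => //.
  rewrite ltr_pM2r ?ltr0n // natrM; lra.
pose t k := Num.truncn ((y 0 k - x 0 k + B%:R) * K.+1%:R).
have tk k : (t k < 2 * B * K.+1 + 1)%N.
  have /andP[h0 h1] := yk k; rewrite -(ltr_nat R).
  by apply: le_lt_trans h1; have /andP[] := truncn_itv h0.
exists (g [ffun k => Ordinal (tk k)]); first by apply: map_f; rewrite mem_enum.
apply: norm_le_coord => [|a k]; first by rewrite invr_ge0.
rewrite ord1 !mxE ffunE /=; have /andP[h0 h1] := yk k.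
have /andP[t0 t1] := truncn_itv h0; rewrite -/(t k) in t0 t1.
have K0 : 0 < K.+1%:R :> R by rewrite ltr0n.
rewrite ler_norml; apply/andP; split; rewrite -(ler_pM2r K0).
  rewrite mulNr mulVf ?gt_eqF //.
  have -> : (y 0 k - (x 0 k - B%:R + (t k)%:R / K.+1%:R)) * K.+1%:R =
    (y 0 k - x 0 k + B%:R) * K.+1%:R - (t k)%:R by field; rewrite gt_eqF.
  lra.
rewrite mulVf ?gt_eqF //.
have -> : (y 0 k - (x 0 k - B%:R + (t k)%:R / K.+1%:R)) * K.+1%:R =
  (y 0 k - x 0 k + B%:R) * K.+1%:R - (t k)%:R by field; rewrite gt_eqF.
rewrite -natr1 in t1; lra.
Qed.
End BoxDimension.
(* [Baire] needs the join of completeness and norm, which is not inferred. *)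
HB.instance Definition _ (R : realType) (m n : nat) := Complete.on 'M[R]_(m, n).

Section ThinSets.
Variable R : realType.

Lemma box_dim_le_lipschitz k n m (S : set 'rV[R]_k) (F : 'rV[R]_k -> 'rV[R]_n) (L : R) :
  box_dim_le m S -> (forall x y, S x -> S y -> `|F x - F y| <= L * `|x - y|) ->
  box_dim_le m (F @` S).
Proof.
move=> [C HC] FL; pose D := (Num.bound (2 * `|L|)).+1.
have DL : 2 * `|L| < D%:R.
  by apply: lt_trans (unstable.ltr_bound _) _; rewrite ltr_nat.
exists (C * D ^ m)%N => K; have [s sz Hs] := HC (D * K.+1).-1.
have DK0 : (0 < D * K.+1)%N by rewrite muln_gt0.
rewrite prednK // in sz Hs.
(* [F] is controlled on [S] only, so each centre is traded for a nearby point of [S], when there is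
   one. This doubles the radius, whence the factor 2 in [D]. *)
pose P y x := S x /\ `|x - y| <= (D * K.+1)%:R^-1.
pose c y := xget 0 (P y).
exists [seq F (c y) | y <- s]; first by rewrite size_map -mulnA -expnMn.
move=> _ [x Sx <-]; have [y ys xy] := Hs x Sx.
exists (F (c y)); first exact: map_f.
have [Sc cy] : P y (c y) by apply: (@xgetPex _ 0); exists x.
apply: le_trans (FL _ _ Sx Sc) _.
have : `|x - c y| <= 2 * (D * K.+1)%:R^-1.
  rewrite -[x - c y](subrKA y); apply: le_trans (ler_normD _ _) _.
  by rewrite mulr_natl mulr2n lerD // distrC.
move=> h; apply: (@le_trans _ _ (`|L| * (2 * (D * K.+1)%:R^-1))).
  apply: (@le_trans _ _ (`|L| * `|x - c y|)); first by rewrite ler_wpM2r // ler_norm.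
  by rewrite ler_wpM2l.
rewrite natrM invfM mulrA mulrA -[leRHS]mul1r ler_wpM2r ?invr_ge0 //.
rewrite ler_pdivrMr ?ltr0n // mul1r mulrC; exact: ltW.
Qed.

(** Combining the centres of the base with a grid of parameters costs one power of the scale. Half
    of the tolerance goes to rounding [t] to a multiple of [1 / K2], half to rounding the base
    point, an error multiplied by at most [T]. *)
Lemma box_dim_le_cone n m (S : set 'rV[R]_n) y (T : nat) : box_dim_le m S ->
  box_dim_le m.+1 [set w | exists s t, [/\ S s, 0 <= t <= T%:R & w = y + t *: (s - y)]].
Proof.
move=> bS; have [B0 HB0] := box_dim_le_bounded bS; have [C HC] := bS.
pose B := (B0 + (Num.bound `|y|)).+1.
have HB s : S s -> `|s - y| <= B%:R.
  move=> /HB0 sB; apply: le_trans (ler_normB _ _) _.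
  rewrite -natr1 natrD; apply: ler_wpDr => //; rewrite lerD //.
  by apply: ltW; apply: unstable.ltr_bound.
exists (C * (2 * T.+1) ^ m * (T * (2 * B) + 1))%N => K.
have [s sz Hs] := HC (2 * T.+1 * K.+1).-1.
have TK0 : (0 < 2 * T.+1 * K.+1)%N by rewrite !muln_gt0.
rewrite prednK // in sz Hs.
pose K2 := (2 * B * K.+1)%N.
have K20 : 0 < K2%:R :> R by rewrite ltr0n !muln_gt0.
exists [seq y + (l%:R / K2%:R) *: (c - y) | c <- s, l <- iota 0 (T * K2 + 1)].
  rewrite size_allpairs size_iota.
  apply: (@leq_trans (C * (2 * T.+1 * K.+1) ^ m * (T * K2 + 1))%N).
    by rewrite leq_mul2r sz orbT.
  rewrite /K2 expnMn expnS.
  have : (T * (2 * B * K.+1) + 1 <= (T * (2 * B) + 1) * K.+1)%N by nia.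
  set a := (T * (2 * B * K.+1) + 1)%N; set b := (_ + 1)%N.
  move=> ab; rewrite [X in (_ <= X)%N](_ : _ = C * ((2 * T.+1) ^ m * K.+1 ^ m) * (b * K.+1))%N; last by ring.
  by rewrite leq_mul2l ab orbT.
move=> _ [x [t [Sx /andP[t0 tT] ->]]].
have [c cs xc] := Hs x Sx.
have tK0 : 0 <= t * K2%:R by rewrite mulr_ge0 // ltW.
pose l := Num.truncn (t * K2%:R); have /andP[l0 l1] := truncn_itv tK0.
rewrite -/l in l0 l1.
exists (y + (l%:R / K2%:R) *: (c - y)).
  apply/allpairsP; exists (c, l); split=> //=; rewrite mem_iota /= add0n addn1 ltnS.
  rewrite -(ler_nat R); apply: le_trans l0 _; rewrite natrM ler_pM2r //.
have -> : y + t *: (x - y) - (y + (l%:R / K2%:R) *: (c - y)) =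
  (t - l%:R / K2%:R) *: (x - y) + (l%:R / K2%:R) *: (x - c).
  by apply/rowP => k; rewrite !mxE; ring.
apply: le_trans (ler_normD _ _) _.
rewrite [`|(t - _) *: _|]normrZ [`|_ *: (x - c)|]normrZ.
have lt : l%:R / K2%:R <= t by rewrite ler_pdivrMr.
have e2 : K.+1%:R^-1 = K.+1%:R^-1 / 2 + K.+1%:R^-1 / 2 :> R by exact: splitr.
rewrite e2 lerD //.
- apply: (@le_trans _ _ (K2%:R^-1 * B%:R)).
    rewrite ler_pM // ?HB // ger0_norm ?subr_ge0 //.
    rewrite -(ler_pM2r K20) mulrBl divfK ?gt_eqF // mulVf ?gt_eqF //.
    rewrite -natr1 in l1; lra.
  rewrite /K2 !natrM [leLHS](_ : _ = K.+1%:R^-1 / 2) //.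
  by field; rewrite !nat1r !pnatr_eq0.
- apply: (@le_trans _ _ (T.+1%:R * (2 * T.+1 * K.+1)%:R^-1)).
    rewrite [`|l%:R / _|]ger0_norm ?divr_ge0 //; apply: ler_pM => //.
    by apply: le_trans lt _; apply: le_trans tT _; rewrite ler_nat.
  rewrite !natrM [leLHS](_ : _ = K.+1%:R^-1 / 2) //.
  by field; rewrite !nat1r !pnatr_eq0.
Qed.

(** Countable unions are built in, because noncompact parameter spaces and unbounded cones admit no
    single covering constant. *)
Definition thin n (m : nat) (W : set 'rV[R]_n) :=
  exists (I : countType) (S : I -> set 'rV[R]_n),
    (forall i, box_dim_le m (S i)) /\ W `<=` \bigcup_i S i.

Lemma thin_sub n m (W W' : set 'rV[R]_n) : W `<=` W' -> thin m W' -> thin m W.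
Proof. by move=> WW [I [S [HS h]]]; exists I, S; split=> // x /WW /h. Qed.

Lemma thin_bigcup n m (I : countType) (W : I -> set 'rV[R]_n) :
  (forall i, thin m (W i)) -> thin m (\bigcup_i W i).
Proof.
move=> tW; pose J i := sval (cid (tW i)).
have HJ i : exists S : J i -> set 'rV[R]_n,
    (forall j, box_dim_le m (S j)) /\ W i `<=` \bigcup_j S j := svalP (cid (tW i)).
pose S i := sval (cid (HJ i)).
have HS i : (forall j, box_dim_le m (S i j)) /\ W i `<=` \bigcup_j S i j := svalP (cid (HJ i)).
exists {i : I & J i}, (fun p => S (tag p) (tagged p)).
split=> [[i j] /=|x [i _ Wx]]; first by have [] := HS i.
by have [_ /(_ x Wx)[j _ Sx]] := HS i; exists (existT _ i j).
Qed.

Lemma thinU n m (W W' : set 'rV[R]_n) : thin m W -> thin m W' -> thin m (W `|` W').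
Proof.
move=> tW tW'; apply: (@thin_sub _ _ _ (\bigcup_(b in [set: bool]) if b then W else W')).
  by move=> x [Wx|Wx]; [exists true|exists false].
by apply: thin_bigcup => -[].
Qed.

Lemma thin_cone n m (W : set 'rV[R]_n) y : thin m W ->
  thin m.+1 [set w | exists s t, [/\ W s, 0 <= t & w = y + t *: (s - y)]].
Proof.
move=> [I [S [HS h]]].
exists (I * nat)%type, (fun p => [set w | exists s t, [/\ S p.1 s, 0 <= t <= p.2%:R & w = y + t *: (s - y)]]).
split=> [[i T]|w [s [t [/h[i _ Ss] t0 ->]]]]; first exact: box_dim_le_cone.
exists (i, Num.bound t) => //=; exists s, t; split=> //.
by rewrite t0 ltW // unstable.ltr_bound.
Qed.

(** The balls of radius [1 / (N+1)] about points of the grid [Z^k / (N+1)] form a countable family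
    with arbitrarily small members around every point. Those on which [F] is Lipschitz still cover
    [U], since [F] is locally Lipschitz. *)
Lemma thin_smooth_image k n (U : set 'rV[R]_k) (F : 'rV[R]_k -> 'rV[R]_n) :
  open U -> smooth_on U F -> thin k (F @` U).
Proof.
move=> oU smF.
pose ctr (p : nat * 'rV[int]_k) : 'rV[R]_k := \row_i ((p.2 0 i)%:~R / p.1.+1%:R).
pose b p := ball (ctr p) (p.1.+1%:R^-1 : R).
pose good p := exists L : R, forall x y, b p x -> b p y -> `|F x - F y| <= L * `|x - y|.
exists (nat * 'rV[int]_k)%type, (fun p => [set v | good p /\ (F @` b p) v]); split=> [p|].
  have [[L FL]|ng] := pselect (good p).
    apply: (@box_dim_le_sub _ _ _ _ (F @` b p)); first by move=> v [].
    exact: (box_dim_le_lipschitz (box_dim_le_ball _ _) FL).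
  by apply: (box_dim_le_sub _ (@box_dim_le_empty R n k)) => v [].
move=> _ [u Uu <-]; have [r [L [r0 _ _ FL]]] := locally_lipschitz oU Uu smF.
pose N := Num.bound (2 / r).
have Nr : 2 / N.+1%:R < r.
  rewrite ltr_pdivrMr ?ltr0n // mulrC -ltr_pdivrMr //.
  by apply: lt_trans (unstable.ltr_bound _) _; rewrite ltr_nat.
have N0 : 0 < N.+1%:R :> R by rewrite ltr0n.
pose p : nat * 'rV[int]_k := (N, \row_i Num.floor (u 0 i * N.+1%:R)).
have bu : `|ctr p - u| < N.+1%:R^-1.
  have [e0|ne] := eqVneq `|ctr p - u| 0; first by rewrite e0 invr_gt0.
  have [[a i] /= e] := mx_norm_neq0 ne.
  have {e} -> : `|ctr p - u| = `|(ctr p - u) a i| := e.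
  rewrite ord1 !mxE /=; have /andP[f0 f1] := floor_itv (u 0 i * N.+1%:R).
  rewrite intrD in f1; set z := (Num.floor _)%:~R in f0 f1 *.
  rewrite -(ltr_pM2r N0) mulVf ?gt_eqF // -[X in _ * X]gtr0_norm // -normrM mulrBl divfK ?gt_eqF //.
  by rewrite ltr_norml; apply/andP; split; lra.
have sub : b p `<=` ball u r.
  move=> x; rewrite /b -!ball_normE /= => px; apply: lt_trans Nr.
  rewrite -[u - x](subrKA (ctr p)); apply: le_lt_trans (ler_normD _ _) _.
  by rewrite distrC mulr_natl mulr2n ltrD.
exists p => //; split.
  by exists L => x y /sub bx /sub by_; apply: FL.
by exists u => //; rewrite /b -ball_normE.
Qed.

(** The closure of a piece has the same box bound and hence contains no ball; its complement is open
    and dense, and Baire's theorem applies. *)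
Lemma thin_avoid n m (W : set 'rV[R]_n) (O : set 'rV[R]_n) : (m < n)%N -> thin m W ->
  open O -> O !=set0 -> exists2 y, O y & ~ W y.
Proof.
move=> mn [I [S [HS h]]] oO O0.
(* Numbers that code no index contribute the empty set. *)
pose F (i : nat) : set 'rV[R]_n := ~` closure (if unpickle i is Some j then S j else set0).
have bF i : box_dim_le m (if unpickle i is Some j then S j else set0).
  by case: (unpickle i) => [j|]; [apply: HS|apply: box_dim_le_empty].
have [i|y [Oy Fy]] := @Baire R 'rV[R]_n F _ O O0 oO.
  split; first by apply: closed_openC; apply: closed_closure.
  move=> V [x Vx] oV; apply: contrapT => /nonemptyPn /disjoints_subset sub.
  have [r /= r0 xrV] := (nbhs_ballP _ _).1 (open_nbhs_nbhs (conj oV Vx)).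
  apply: (box_dim_le_no_ball mn r0 (box_dim_le_closure (bF i))).
  by move=> z /xrV /sub; rewrite /F setCK.
exists y => // /h[j _ Sy]; apply: (Fy (pickle j) Logic.I).
by rewrite pickleK; apply: subset_closure.
Qed.

(** If the segment from [y] to [w] meets [W] at a parameter [t > 0], then [w] lies on the ray from
    [y] through that point, at parameter [1 / t]. So [w] is chosen off the cones over [W] from [y]
    and from [z]; the ends [y] and [z] themselves are off [W] by assumption. *)
Lemma thin_segments n m (W : set 'rV[R]_n) (a : 'rV[R]_n) (r : R) y z : (m.+1 < n)%N -> thin m W ->
  0 < r -> ~ W y -> ~ W z -> exists2 w, ball a r w &
    forall t : R, 0 <= t <= 1 -> ~ W (y + t *: (w - y)) /\ ~ W (w + t *: (z - w)).
Proof.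
move=> mn tW r0 Wy Wz.
have [w aw Cw] := thin_avoid mn (thinU (thin_cone y tW) (thin_cone z tW))
  (ball_open a r) (ex_intro _ a (ballxx a r0)).
exists w => // t /andP[t0 t1]; split=> Wt.
- have [t00|tn] := eqVneq t 0; first by rewrite t00 scale0r addr0 in Wt.
  apply: Cw; left; exists (y + t *: (w - y)), t^-1; split=> //; first by rewrite invr_ge0.
  by rewrite [_ - y]addrC addKr scalerA mulVf // scale1r subrKC.
- have [t00|tn] := eqVneq t 1; first by rewrite t00 scale1r subrKC in Wt.
  apply: Cw; right; exists (w + t *: (z - w)), (1 - t)^-1; split=> //.
    by rewrite invr_ge0 subr_ge0.
  have t1n : 1 - t != 0 by rewrite subr_eq0 eq_sym.
  by apply/rowP => k; rewrite !mxE; field.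
Qed.

End ThinSets.
(** * Charts and smooth maps *)

Section NearEqDiff.
Variables (R : realType) (V W : normedModType R).

(** Identities between chart expressions hold only near a point, as [chart_inv] is arbitrary off the
    image; differentials are transferred across them here. *)
Lemma near_eq_diff (f g : V -> W) x : (\forall y \near x, f y = g y) ->
  differentiable f x -> differentiable g x /\ 'd g x = 'd f x :> (V -> W).
Proof.
move=> fg /diff_locallyP[cf ef].
have fgx : f x = g x by exact: nbhs_singleton fg.
have eg : g \o shift x = cst (g x) + 'd f x +o_ (0 : V) id.
  apply/eqaddoP => e e0; move/eqaddoP/(_ e e0): ef.
  have fg0 : \forall h \near 0, f (h + x) = g (h + x).
    by move: fg; rewrite (near_shift 0) subr0 /=; apply: filterS => h /=.
  apply: filterS2 fg0 => h /= fgh.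
  by rewrite /= !fctE /= fgh fgx.
have dg : 'd g x = 'd f x :> (V -> W) := @diff_unique R V W g ('d f x) x cf eg.
split; last exact: dg.
by apply/diff_locallyP; rewrite dg; split; [exact: cf|exact: eg].
Qed.

End NearEqDiff.

Lemma iter_continuous (T : topologicalType) (f : T -> T) m :
  continuous f -> continuous (iter m f).
Proof.
move=> cf; elim: m => [|m IH] x; first exact: cvg_id.
by apply: (@continuous_comp _ _ _ (iter m f) f x); [exact: IH|exact: cf].
Qed.

Section Charts.
Context {R : realType} {M : topologicalType} {n : nat}.
Implicit Types (phi : chart R M n).

Lemma chart_continuous phi x : is_chart phi -> chart_dom phi x -> {for x, continuous phi}.
Proof.
move=> [oD _ _ c _] Dx; rewrite continuous_open_subspace // in c.
by apply: c; rewrite inE.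
Qed.

Lemma chart_inv_continuous phi u : is_chart phi -> (phi @` chart_dom phi) u ->
  {for u, continuous (chart_inv phi)}.
Proof.
move=> [_ oD _ _ c] Du; rewrite continuous_open_subspace // in c.
by apply: c; rewrite inE.
Qed.

Lemma chart_ballP phi x (V : set M) : is_chart phi -> chart_dom phi x -> nbhs x V ->
  exists2 r : R, 0 < r & forall u, ball (phi x) r u ->
    [/\ chart_dom phi (chart_inv phi u), phi (chart_inv phi u) = u & V (chart_inv phi u)].
Proof.
move=> ch Dx Vx; have [oD oI K _ _] := ch.
have c : {for phi x, continuous (chart_inv phi)}.
  by apply: chart_inv_continuous => //; exists x.
have /c nV : nbhs (chart_inv phi (phi x)) V by rewrite K.
have nI : nbhs (phi x) (phi @` chart_dom phi).
  by apply: open_nbhs_nbhs; split=> //; exists x.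
have [r /= r0 Hr] := (nbhs_ballP _ _).1 (filterI nI nV).
exists r => // u /Hr [[y Dy <-] Vy]; rewrite /= K // in Vy *.
Qed.

Lemma chart_ball_nbhs phi x (r : R) : is_chart phi -> chart_dom phi x -> 0 < r ->
  nbhs x [set y | chart_dom phi y /\ ball (phi x) r (phi y)].
Proof.
move=> ch Dx r0; have [oD _ _ _ _] := ch; apply: filterI.
  exact: open_nbhs_nbhs.
by apply: (chart_continuous ch Dx); apply: nbhsx_ballx.
Qed.

Lemma chart_cvg phi x (z : nat -> M) : is_chart phi -> chart_dom phi x ->
  (forall k, chart_dom phi (z k)) -> (fun k => phi (z k)) @ \oo --> phi x -> z @ \oo --> x.
Proof.
move=> ch Dx Dz cz; have [_ _ K _ _] := ch.
have c : {for phi x, continuous (chart_inv phi)}.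
  by apply: chart_inv_continuous => //; exists x.
have := @cvg_comp _ _ _ (fun k => phi (z k)) (chart_inv phi) _ _ _ cz c.
rewrite K // (_ : _ \o _ = z) //.
by apply/funext => k /=; rewrite K.
Qed.

End Charts.

Section SmoothMaps.
Context {R : realType}.

Lemma rep_dom_open (M N : topologicalType) m n (phi : chart R M m) (psi : chart R N n)
    (F : M -> N) : is_chart phi -> is_chart psi -> continuous F -> open (rep_dom phi psi F).
Proof.
move=> cphi [oD' _ _ _ _] cF; rewrite openE => _ [x [Dx Dy] <-].
have nV : nbhs x (F @^-1` chart_dom psi).
  by apply: cF; apply: open_nbhs_nbhs.
have [r r0 Hr] := chart_ballP cphi Dx nV.
apply/nbhs_ballP; exists r => // u /Hr [Du uE Vu].
by exists (chart_inv phi u).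
Qed.

Lemma smooth_on_differentiable m n (U : set 'rV[R]_m) (F : 'rV[R]_m -> 'rV[R]_n) x :
  smooth_on U F -> U x -> differentiable F x.
Proof. by move=> /(_ 1%N)[dF _] /dF. Qed.

Definition immersive_at (M : topologicalType) n (A : set (chart R M n)) k
    (j : 'rV[R]_k -> M) (u : 'rV[R]_k) :=
  forall phi, A phi -> chart_dom phi (j u) ->
    differentiable (phi \o j) u /\ injective ('d (phi \o j : 'rV[R]_k -> 'rV[R]_n) u).

Lemma immersed_copy_smooth_on (M : topologicalType) n (A : set (chart R M n)) k
    (j : 'rV[R]_k -> M) phi : smooth_map (@euclidean_atlas R k) A j -> A phi ->
  smooth_on (j @^-1` chart_dom phi) (phi \o j).
Proof.
move=> [_ /(_ (Chart setT id id) phi erefl)] /[apply].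
rewrite /rep_dom /local_rep /=.
by rewrite image_id setTI.
Qed.

Lemma immersed_copy_immersive (M : topologicalType) n (A : set (chart R M n)) k W
    (j : 'rV[R]_k -> M) u : immersed_copy A W j -> immersive_at A j u.
Proof.
move=> [sj ij _ _] phi Aphi Du; split; last exact: ij.
exact: (smooth_on_differentiable (immersed_copy_smooth_on sj Aphi)).
Qed.

End SmoothMaps.

Section Diffeos.
Context {R : realType} {M : topologicalType} {n : nat} {A : set (chart R M n)}.
Hypothesis atlas : smooth_atlas A.

Lemma atlas_chart phi : A phi -> is_chart phi.
Proof. by case: atlas => h _ _; apply: h. Qed.

Lemma local_rep_smooth (F : M -> M) phi psi : smooth_map A A F -> A phi -> A psi ->
  smooth_on (rep_dom phi psi F) (local_rep phi psi F).
Proof. by move=> [_ h]; apply: h. Qed.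

(** The chart representative [L] of [f] has the local left inverse [L']; differentiating
    [L' \o L = id] shows that the differential of [L] is injective. *)
Lemma immersive_at_diffeo (f : diffeo A) k (j : 'rV[R]_k -> M) u :
  continuous j -> immersive_at A j u -> immersive_at A (f \o j) u.
Proof.
move=> cj ij phi Aphi Du.
have [_ cov _] := atlas; have [psi Apsi Dpsi] := cov (j u).
have cphi := atlas_chart Aphi; have cpsi := atlas_chart Apsi.
have [_ _ Kpsi _ _] := cpsi; have [_ _ Kphi _ _] := cphi.
have [dj inj] := ij psi Apsi Dpsi.
pose L := local_rep psi phi f; pose L' := local_rep phi psi (diffeo_inv f).
have sf := diffeo_smooth f; have sg := diffeo_inv_smooth f.
have dL : differentiable L ((psi \o j) u).
  apply: (smooth_on_differentiable (local_rep_smooth sf Apsi Aphi)).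
  by exists (j u).
have LE : L ((psi \o j) u) = phi (f (j u)) by rewrite /L /local_rep /= Kpsi.
have dL' : differentiable L' (L ((psi \o j) u)).
  apply: (smooth_on_differentiable (local_rep_smooth sg Aphi Apsi)).
  by rewrite LE; exists (f (j u)) => //; split=> //=; rewrite diffeo_funK.
have nearL : \forall y \near u, (L \o (psi \o j)) y = (phi \o (f \o j)) y.
  have : nbhs u (j @^-1` chart_dom psi).
    by apply: cj; apply: open_nbhs_nbhs; split=> //; case: cpsi.
  by apply: filterS => y Dy; rewrite /L /local_rep /= Kpsi.
have dc : differentiable (L \o (psi \o j)) u by exact: differentiable_comp.
have [dd eqd] := near_eq_diff nearL dc.
split; first exact: dd.
rewrite eqd (diff_comp dj dL); apply: inj_comp inj.
have nearid : \forall y \near (psi \o j) u, (L' \o L) y = id y.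
  have nf : nbhs (j u) (f @^-1` chart_dom phi).
    have [cf _] := sf; have [oD _ _ _ _] := cphi.
    exact: (cf (j u) _ (open_nbhs_nbhs (conj oD Du))).
  have [r r0 Hr] := chart_ballP cpsi Dpsi nf.
  apply: (filterS _ (nbhsx_ballx (psi (j u)) r r0)) => y /Hr [Dy yE fy].
  rewrite /= /L' /L /local_rep.
  have -> := Kphi _ fy.
  by rewrite diffeo_funK yE.
have dc' : differentiable (L' \o L) ((psi \o j) u) by exact: differentiable_comp.
have [_ eqid] := near_eq_diff nearid dc'.
have idv : 'd (id : 'rV[R]_n -> 'rV[R]_n) ((psi \o j) u) = id :> (_ -> _).
  exact: (diff_val (is_diff_def := is_diff_id _)).
have eqv := etrans (esym idv) (etrans eqid (diff_comp dL dL')).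
apply: (@can_inj _ _ _ ('d L' (L ((psi \o j) u)))) => v.
exact: esym (congr1 (fun h : 'rV[R]_n -> 'rV[R]_n => h v) eqv).
Qed.

Lemma immersive_at_iter (f : diffeo A) k (j : 'rV[R]_k -> M) u m :
  continuous j -> immersive_at A j u -> immersive_at A (iter m f \o j) u.
Proof.
move=> cj ij; elim: m => [//|m IH].
apply: (@immersive_at_diffeo f k (iter m f \o j)); last exact: IH.
move=> x; apply: (@continuous_comp _ _ _ j (iter m f) x); first exact: cj.
exact: (iter_continuous (m := m) (diffeo_smooth f).1).
Qed.

End Diffeos.
(** * Local dynamics at a hyperbolic fixed point *)

Section Adapted.
Context {R : realType} {M : topologicalType} {n : nat}.

(* The same N serves f with H and its inverse with -H, which makes the stable
   and unstable sides interchangeable. *)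
Record adapted (f : M -> M) (p : M) (phi : chart R M n) (N : set M)
    (H : 'M[R]_n) (c : R) : Prop := Adapted {
  adapted_chart : is_chart phi;
  adapted_fixed : f p = p;
  adapted_dom : N `<=` chart_dom phi;
  adapted_nbhs : nbhs p N;
  adapted_closed : closed N;
  adapted_bounded : exists r : R, forall x, N x -> `|phi x - phi p| <= r;
  adapted_gt0 : 0 < c;
  adapted_lyapunov : forall x y, N x -> N y -> N (f x) -> N (f y) ->
    qform H (phi x - phi y) + c * `|phi x - phi y| ^+ 2 <=
    qform H (phi (f x) - phi (f y)) }.

(** Strict differentiability bounds the nonlinear error by half of [c0]. For the inverse the
    inequality is read backwards: its gain is then measured on the images under the inverse, and the
    Lipschitz bound [BJ + 1] of [f] expresses it by the points themselves. *)
Lemma hyperbolic_adapted (A : set (chart R M n)) (f : diffeo A) p :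
  closed_smooth_manifold A -> hyperbolic_fixed_point f p ->
  exists phi N H c, [/\ A phi, adapted f p phi N H c &
    exists c', adapted (diffeo_inv f) p phi N (- H) c'].
Proof.
move=> [hM _ _ atlas] [fp hyp]; have [_ cov _] := atlas.
have [phi Aphi Dp] := cov p; have cphi := atlas_chart atlas Aphi.
have [oD oI K _ _] := cphi.
pose F := local_rep phi phi f; pose U := rep_dom phi phi f.
have oU : open U by apply: rep_dom_open => //; case: (diffeo_smooth f).
have Up : U (phi p) by exists p => //; split=> //=; rewrite fp.
have smF : smooth_on U F by exact: (local_rep_smooth (diffeo_smooth f) Aphi Aphi).
have [H [c0 [c00 Hlin]]] := hyperbolic_lyapunov (hyp phi Aphi Dp).
rewrite -/F in Hlin; set J := 'J F (phi p) in Hlin.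
have [BJ BJ0 HJ] := norm_mulmx_bound J.
have [B B0 [HB HBn]] := qform_near H.
(* The bound 1 keeps the error vector no longer than [v]; the other bound keeps its effect on the
   form below [c0 / 2] times the squared norm of [v]. *)
pose e := Num.min 1 (c0 / 2 / (B * (2 * BJ + 1))).
have BB0 : 0 < B * (2 * BJ + 1) by rewrite mulr_gt0 // addr_gt0 // mulr_gt0.
have e0 : 0 < e by rewrite lt_min ltr01 !divr_gt0.
have e1 : e <= 1 by rewrite ge_min lexx.
have eB : B * (2 * BJ + 1) * e <= c0 / 2.
  by rewrite mulrC -ler_pdivlMr // ge_min lexx orbT.
have [r r0 [rU Hr]] := strict_derivative oU Up smF e0.
rewrite -/J in Hr.
(* A closed ball of the chart: it is compact, hence closed in the Hausdorff space [M], which a set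
   that is merely closed in the chart domain need not be. *)
pose N := [set x | chart_dom phi x /\ `|phi x - phi p| <= r / 2].
have r20 : 0 < r / 2 by rewrite divr_gt0.
have Nball x : N x -> ball (phi p) r (phi x).
  move=> [_ h]; rewrite -ball_normE /= distrC; apply: le_lt_trans h _; lra.
have NF x : N x -> phi (f x) = F (phi x) by move=> [Dx _]; rewrite /F /local_rep K.
have Nn : nbhs p N.
  apply: filterS (chart_ball_nbhs cphi Dp r20) => x [Dx]; rewrite -ball_normE /= distrC => h.
  by split=> //; apply: ltW.
have NE : N = chart_inv phi @` [set u | `|u - phi p| <= r / 2].
  apply/seteqP; split=> [x [Dx h]|_ [u /= h <-]].
    by exists (phi x); rewrite ?K.
  have [x [Dx _] xu] : U u.
    by apply: rU; rewrite -ball_normE /= distrC; apply: le_lt_trans h _; lra.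
  by rewrite -xu K // /N /= xu.
have Nc : closed N.
  apply: (compact_closed hM); rewrite NE; apply: continuous_compact.
    apply: (@continuous_subspaceW _ _ _ (phi @` chart_dom phi)); last by case: cphi.
    move=> u /= h; have [x [Dx _] xu] : U u.
      by apply: rU; rewrite -ball_normE /= distrC; apply: le_lt_trans h _; lra.
    by exists x.
  apply: bounded_closed_compact.
    exists (`|phi p| + r / 2); split; first exact: num_real.
    move=> x xr u /= h; apply: le_trans (ltW xr); rewrite -(subrK (phi p) u) addrC.
    by apply: le_trans (ler_normD _ _) _; rewrite lerD2l.
  have -> : [set u | `|u - phi p| <= r / 2] = closed_ball (phi p) (r / 2).
    by rewrite closed_ballE // /closed_ball_; apply/seteqP; split=> u /=; rewrite distrC.
  exact: closed_ball_closed.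
have lyap x y : N x -> N y ->
  qform H (phi x - phi y) + c0 / 2 * `|phi x - phi y| ^+ 2 <=
    qform H (phi (f x) - phi (f y)).
  move=> Nx Ny; rewrite (NF x Nx) (NF y Ny).
  set v := phi x - phi y; have hv := Hr _ _ (Nball x Nx) (Nball y Ny); rewrite -/v in hv.
  set d := F (phi x) - F (phi y) in hv *.
  have h1 := Hlin v; have h2 := HBn (v *m J) (d - v *m J); have h3 := HJ v.
  rewrite addrCA subrr addr0 in h2; set E := d - v *m J in hv h2.
  have v0 : 0 <= `|v| by []. have E0 : 0 <= `|E| by [].
  have h4 : B * (2 * `|v *m J| + `|E|) * `|E| <= c0 / 2 * `|v| ^+ 2.
    apply: (@le_trans _ _ (B * (2 * BJ + 1) * e * `|v| ^+ 2)); last by rewrite ler_wpM2r ?sqr_ge0.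
    have -> : B * (2 * BJ + 1) * e * `|v| ^+ 2 = B * ((2 * BJ + 1) * `|v|) * (e * `|v|) by ring.
    have EV : `|E| <= `|v| by apply: le_trans hv _; rewrite ler_piMl.
    apply: ler_pM => //; first by rewrite mulr_ge0 ?(ltW B0) // addr_ge0 // mulr_ge0.
    by rewrite ler_wpM2l ?(ltW B0) //; lra.
  move: h2; rewrite ler_norml => /andP[h2 _]; lra.
have lip x y : N x -> N y -> `|phi (f x) - phi (f y)| <= (BJ + 1) * `|phi x - phi y|.
  move=> Nx Ny; rewrite (NF x Nx) (NF y Ny).
  set v := phi x - phi y; have hv := Hr _ _ (Nball x Nx) (Nball y Ny); rewrite -/v in hv.
  rewrite -(subrK (v *m J) (F (phi x) - F (phi y))).
  apply: le_trans (ler_normD _ _) _.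
  have ev : e * `|v| <= `|v| by rewrite ler_piMl.
  have := HJ v; lra.
have bd : exists r : R, forall x, N x -> `|phi x - phi p| <= r.
  by exists (r / 2) => x [].
exists phi, N, H, (c0 / 2); split=> //.
  split=> //; first by move=> x [].
  - by rewrite divr_gt0.
  - by move=> x y Nx Ny _ _; apply: lyap.
have L0 : 0 < (BJ + 1) ^+ 2 by rewrite exprn_gt0 // addr_gt0.
exists (c0 / 2 / (BJ + 1) ^+ 2); split=> //.
- by rewrite -{1}fp diffeo_funK.
- by move=> x [].
- by rewrite !divr_gt0.
move=> x y Nx Ny Ngx Ngy; have := lyap _ _ Ngx Ngy; have := lip _ _ Ngx Ngy.
rewrite !diffeo_invK !qformN => h1 h2.
set d := `|phi x - phi y| in h1 *; set d' := `|phi (diffeo_inv f x) - _| in h1 h2 *.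
have h3 : c0 / 2 / (BJ + 1) ^+ 2 * d ^+ 2 <= c0 / 2 * d' ^+ 2.
  rewrite mulrAC ler_pdivrMr // -[leRHS]mulrA ler_wpM2l //; first by rewrite divr_ge0 // ltW.
  have dd : d <= d' * (BJ + 1) by rewrite mulrC.
  by rewrite -exprMn !expr2; apply: ler_pM => //; exact: normr_ge0.
lra.
Qed.

End Adapted.
Lemma qform_continuous (R : realType) n (H : 'M[R]_n) : continuous (qform H).
Proof.
move=> v; have [B B0 [_ HB]] := qform_near H.
apply: (iffRL (@cvgrPdist_lt R R^o _ (nbhs v) (nbhs_filter v) (qform H) (qform H v))) => e e0.
pose s := 2 * `|v| + 1; have s0 : 0 < s by rewrite ltr_wpDl // mulr_ge0.
pose d := Num.min 1 (e / (B * s)).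
have d0 : 0 < d by rewrite lt_min ltr01 divr_gt0 // mulr_gt0.
apply: filterS (nbhsx_ballx v d d0) => u; rewrite -ball_normE /= => uv.
rewrite distrC in uv; have u1 : `|u - v| < 1 by apply: lt_le_trans uv _; rewrite ge_min lexx.
have ue : `|u - v| < e / (B * s) by apply: lt_le_trans uv _; rewrite ge_min lexx orbT.
have := HB v (u - v); rewrite [v + _]addrC subrK distrC => h.
apply: le_lt_trans h _; apply: (@le_lt_trans _ _ (B * s * `|u - v|)).
  by rewrite ler_wpM2r // ler_wpM2l ?(ltW B0) // lerD2l ltW.
by rewrite mulrC -ltr_pdivlMr // mulr_gt0.
Qed.

(** If [q 0] were positive, [q] would never fall below it, so [s] would stay above [q 0 / B] and
    each step would add at least [c * (q 0 / B)], against the bound [B * b]. *)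
Lemma neg_quadratic_growth (R : realType) (q s : nat -> R) (c B b : R) :
  0 < c -> 0 < B -> (forall k, 0 <= s k) -> (forall k, q k <= B * s k) ->
  (forall k, s k <= b) -> (forall k, q k + c * s k <= q k.+1) -> q 0%N <= 0.
Proof.
move=> c0 B0 s0 qs sb qq; rewrite leNgt; apply/negP => q0.
have mono k : q 0%N <= q k.
  elim: k => [//|k IH]; apply: le_trans IH _; apply: le_trans (qq k).
  by rewrite lerDl mulr_ge0 // ltW.
have step k : q 0%N + k%:R * (c * (q 0%N / B)) <= q k.
  elim: k => [|k IH]; first by rewrite mul0r addr0.
  apply: le_trans (qq k); rewrite -natr1 mulrDl mul1r addrA lerD //.
  rewrite ler_wpM2l ?(ltW c0) // ler_pdivrMr // mulrC.
  exact: le_trans (mono k) (qs k).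
pose k := Num.bound (B * b / (c * (q 0%N / B))).
have e0 : 0 < c * (q 0%N / B) by rewrite mulr_gt0 // divr_gt0.
have : B * b < k%:R * (c * (q 0%N / B)) by rewrite -ltr_pdivrMr // unstable.ltr_bound.
apply/negP; rewrite -leNgt.
apply: le_trans (_ : q k <= _).
  by apply: le_trans (step k); rewrite lerDr ltW.
by apply: le_trans (qs k) _; rewrite ler_wpM2l // ltW.
Qed.

Lemma contracting_cvg0 (R : realType) (q s : nat -> R) (c B : R) :
  0 < c -> 0 < B -> (forall k, 0 <= s k) -> (forall k, - q k <= B * s k) ->
  (forall k, q k + c * s k <= q k.+1) -> (forall k, q k + c * s k <= 0) ->
  s @ \oo --> 0.
Proof.
move=> c0 B0 s0 qs qq sq.
(* Each step shrinks [- q] at least by the factor [1 - c / B]. The larger factor [B / (B + c)] is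
   never negative and still below 1. *)
pose t := B / (B + c); have Bc : 0 < B + c by rewrite addr_gt0.
have t0 : 0 <= t by rewrite divr_ge0 ?(ltW B0) ?(ltW Bc).
have t1 : t < 1 by rewrite ltr_pdivrMr // mul1r ltrDl.
have dec k : - q k.+1 <= t * - q k.
  rewrite /t mulrAC ler_pdivlMr //; have := qq k; have := sq k; have := qs k; have := s0 k.
  move=> ? h1 h2 h3; have : (- q k.+1) * (B + c) <= (- q k - c * s k) * (B + c).
    by rewrite ler_wpM2r ?(ltW Bc) //; lra.
  have : c * - q k <= c * (B * s k) by rewrite ler_wpM2l ?(ltW c0).
  have : 0 <= c * c * s k by rewrite !mulr_ge0 // ltW.
  lra.
have geo k : s k <= - q 0%N / c * t ^+ k.
  have : - q k <= - q 0%N * t ^+ k.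
    elim: k => [|k IH]; first by rewrite expr0 mulr1.
    by apply: le_trans (dec k) _; rewrite exprS mulrCA ler_wpM2l.
  move=> h; rewrite mulrAC ler_pdivlMr //; have := sq k; lra.
apply: (@squeeze_cvgr _ _ _ _ (fun _ => 0) (fun k => - q 0%N / c * t ^+ k)).
- by near=> k; rewrite s0 geo.
- exact: cvg_cst.
- rewrite -[X in _ --> X](mulr0 (- q 0%N / c)); apply: cvgM; first exact: cvg_cst.
  by apply: cvg_expr; rewrite ger0_norm.
Unshelve. all: by end_near.
Qed.

Section LocalDynamics.
Context {R : realType} {M : topologicalType} {n : nat}.
Variables (f : M -> M) (p : M) (phi : chart R M n) (N : set M) (H : 'M[R]_n) (c : R).
Hypothesis ad : adapted f p phi N H c.

Let stays x := forall k, N (iter k f x).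

Lemma adapted_inj x y : N x -> N y -> phi x = phi y -> x = y.
Proof.
have [_ _ K _ _] := adapted_chart ad.
by move=> /(adapted_dom ad) Dx /(adapted_dom ad) Dy e; rewrite -(K x) // -(K y) // e.
Qed.

Lemma adapted_center : N p.
Proof. exact: nbhs_singleton (adapted_nbhs ad). Qed.

Lemma iter_fixed k : iter k f p = p.
Proof. by elim: k => //= k ->; exact: adapted_fixed ad. Qed.

Lemma stays_center : stays p.
Proof. by move=> k; rewrite iter_fixed; exact: adapted_center. Qed.

Lemma stays_iter m x : stays x -> stays (iter m f x).
Proof. by move=> sx k; rewrite -iterD. Qed.

(** Differences of orbits that stay in [N] are bounded, so the form is never positive along them.
    Knowing this at time 1, one Lyapunov step gives the definite bound at time 0. *)
Lemma stays_negative x y : stays x -> stays y ->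
  qform H (phi x - phi y) <= - c * `|phi x - phi y| ^+ 2.
Proof.
move=> sx sy; have [B B0 [HB _]] := qform_near H.
have [r Hr] := adapted_bounded ad.
pose d k := phi (iter k f x) - phi (iter k f y).
have step k : qform H (d k) + c * `|d k| ^+ 2 <= qform H (d k.+1).
  by apply: (adapted_lyapunov ad); rewrite -?iterS.
have neg k : qform H (d k) <= 0.
  have -> : k = (0 + k)%N by [].
  apply: (@neg_quadratic_growth _ (fun i => qform H (d (i + k)%N)) (fun i => `|d (i + k)%N| ^+ 2)
      c B ((r + r) ^+ 2)) => //.
  - exact: adapted_gt0 ad.
  - by move=> i; apply: le_trans (ler_norm _) (HB _).
  - move=> i; have h : `|d (i + k)%N| <= r + r.
      rewrite /d -[X in `|X|](subrKA (phi p)); apply: le_trans (ler_normD _ _) _.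
      by rewrite lerD ?Hr // distrC Hr.
    by rewrite !expr2 ler_pM.
have := neg 1%N; have := step 0%N; rewrite /d /=; lra.
Qed.

Lemma stays_stable x : stays x -> stable_set f p x.
Proof.
move=> sx; have [B B0 [HB _]] := qform_near H.
pose d k := phi (iter k f x) - phi p.
have ds k : qform H (d k) + c * `|d k| ^+ 2 <= 0.
  have := stays_negative (stays_iter k sx) stays_center; rewrite -/(d k); lra.
have : (fun k => `|d k| ^+ 2) @ \oo --> (0 : R).
  apply: (@contracting_cvg0 _ (fun k => qform H (d k)) _ c B) => //.
  - exact: adapted_gt0 ad.
  - by move=> k; apply: le_trans (HB (d k)); rewrite -normrN ler_norm.
  - move=> k; have := @adapted_lyapunov _ _ _ _ _ _ _ _ _ ad (iter k f x) p.
    rewrite (adapted_fixed ad); apply; [exact: sx|exact: adapted_center|exact: (sx k.+1)|exact: adapted_center].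
move=> cv; apply: (chart_cvg (adapted_chart ad) (adapted_dom ad adapted_center)).
  by move=> k; apply: (adapted_dom ad); apply: sx.
apply/cvgrPdist_lt => e e0.
have e20 : 0 < e ^+ 2 by rewrite exprn_gt0.
move/cvgrPdist_lt: cv => /(_ _ e20); apply: filterS => k.
rewrite sub0r normrN ger0_norm ?sqr_ge0 // distrC -/(d k).
by rewrite ltr_sqr ?nnegrE // ltW.
Qed.

Lemma stable_eventually_stays x : stable_set f p x -> exists m, stays (iter m f x).
Proof.
move=> /(_ _ (adapted_nbhs ad)) [m _ Hm]; exists m => k.
by rewrite -iterD; apply: Hm; rewrite /= leq_addl.
Qed.

Lemma repelling_stable_set x : injective f -> (forall v, 0 <= qform H v) ->
  stable_set f p x -> x = p.
Proof.
move=> fi H0 /stable_eventually_stays[m sm].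
have h := stays_negative sm stays_center.
have c0 := adapted_gt0 ad.
have d0 : phi (iter m f x) - phi p = 0.
  apply/eqP; rewrite -normr_eq0 -sqrf_eq0 eq_le sqr_ge0 andbT.
  have := H0 (phi (iter m f x) - phi p); rewrite -(pmulr_rle0 _ c0) => h2; lra.
have : iter m f x = p.
  apply: adapted_inj; [exact: (sm 0%N)|exact: adapted_center|exact: subr0_eq].
have im : injective (iter m f).
  by elim: (m) => [|k IH] a b //= /fi /IH.
by move=> e; apply: im; rewrite e iter_fixed.
Qed.

Hypothesis cf : continuous f.

Lemma adapted_small : exists2 r : R, 0 < r & forall u, ball (phi p) r u ->
  exists x, [/\ phi x = u, N x & N (f x)].
Proof.
have nN : nbhs p (N `&` f @^-1` N).
  apply: filterI; first exact: adapted_nbhs ad.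
  by apply: cf; rewrite (adapted_fixed ad); exact: adapted_nbhs ad.
have [r r0 Hr] := chart_ballP (adapted_chart ad) (adapted_dom ad adapted_center) nN.
by exists r => // u /Hr [_ uE [Nu Nfu]]; exists (chart_inv phi u).
Qed.

(** For small [v] one Lyapunov step from [p + v], compared with [p], ends at a nonpositive value,
    which leaves room for the term in [c]; homogeneity extends this to all [v]. *)
Lemma nonpos_definite : (forall v, qform H v <= 0) ->
  forall v, qform H v <= - c * `|v| ^+ 2.
Proof.
move=> H0 v; have [r r0 Hr] := adapted_small.
have [->|v0] := eqVneq v 0.
  by rewrite normr0 expr0n mulr0 H0.
have nv : 0 < `|v| by rewrite normr_gt0.
pose t := r / 2 / `|v|; have t0 : 0 < t by rewrite !divr_gt0.
have [|x [xE Nx Nfx]] := Hr (phi p + t *: v).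
  rewrite -ball_normE /= opprD addNKr normrN normrZ gtr0_norm // divfK ?gt_eqF //; lra.
have := adapted_lyapunov ad Nx adapted_center Nfx.
rewrite (adapted_fixed ad) => /(_ adapted_center).
rewrite xE [phi p + _]addrC addrK qformZ normrZ gtr0_norm // => h.
have := le_trans h (H0 _).
have -> : t ^+ 2 * qform H v + c * (t * `|v|) ^+ 2 =
  t ^+ 2 * (qform H v + c * `|v| ^+ 2) by ring.
rewrite pmulr_rle0 ?exprn_gt0 //; lra.
Qed.

Lemma attracting_nbhs (V : set M) : (forall v, qform H v <= 0) -> nbhs p V ->
  exists S : set M, [/\ open S, S p, S `<=` V, f @` S `<=` S & S `<=` stable_set f p].
Proof.
move=> /nonpos_definite Hneg nV; have c0 := adapted_gt0 ad.
have cphi := adapted_chart ad; have Dp := adapted_dom ad adapted_center.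
have [oD _ K _ _] := cphi.
have nN : nbhs p (V `&` (N `&` f @^-1` N)).
  apply: filterI => //; apply: filterI; first exact: adapted_nbhs ad.
  by apply: cf; rewrite (adapted_fixed ad); exact: adapted_nbhs ad.
have [r r0 Hr] := chart_ballP cphi Dp nN.
(* A sublevel set of the Lyapunov function [- qform H]. As this function is at least [c] times the
   squared norm, the level [c * r ^+ 2] keeps images in the ball of radius [r]. *)
pose S := [set x | [/\ chart_dom phi x, ball (phi p) r (phi x) &
  - qform H (phi x - phi p) < c * r ^+ 2]].
have SN x : S x -> V x /\ (N x /\ N (f x)).
  by move=> [Dx /Hr[_ _ h] _]; rewrite K // in h.
have Sf x : S x -> S (f x).
  move=> Sx; have [_ [Nx Nfx]] := SN x Sx; have [_ _ qx] := Sx.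
  have := adapted_lyapunov ad Nx adapted_center Nfx.
  rewrite (adapted_fixed ad) => /(_ adapted_center) h.
  have h2 := Hneg (phi (f x) - phi p).
  have h3 : 0 <= c * `|phi x - phi p| ^+ 2 by rewrite mulr_ge0 ?sqr_ge0 // ltW.
  split; [exact: (adapted_dom ad)| |lra].
  rewrite -ball_normE /= distrC -ltr_sqr ?nnegrE ?(ltW r0) // -(ltr_pM2l c0); lra.
exists S; split.
- rewrite openE => x [Dx bx qx].
  have cx := chart_continuous cphi Dx.
  have n1 : nbhs x (chart_dom phi) by exact: open_nbhs_nbhs.
  have n2 : nbhs x (phi @^-1` ball (phi p) r).
    by apply: cx; apply: open_nbhs_nbhs; split=> //; exact: ball_open.
  have n3 : nbhs x (phi @^-1` [set u | - qform H (u - phi p) < c * r ^+ 2]).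
    apply: cx; have cq : {for phi x, continuous (fun u => - qform H (u - phi p))}.
      apply: continuousN; apply: (@continuous_comp _ _ _ (fun u => u - phi p) (qform H)).
        by apply: (@continuousB _ _ _ id (fun _ => phi p)); [move=> u; exact: cvg_id|exact: cst_continuous].
      exact: qform_continuous.
    by move/cvgr_lt: cq => /(_ _ qx).
  by apply: filterS3 n1 n2 n3 => y; split.
- split=> //; first exact: ballxx.
  by rewrite subrr /qform /bform mul0mx mul0mx mxE oppr0 mulr_gt0 // exprn_gt0.
- by move=> x /SN [].
- by move=> _ [x Sx <-]; exact: Sf.
- move=> x Sx; apply: stays_stable => k.
  have : S (iter k f x) by elim: k => //= k; exact: Sf.
  by move/SN => [_ []].
Qed.

End LocalDynamics.
Lemma compact_accumulation (T : topologicalType) (K : set T) (z : nat -> T) :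
  compact K -> (forall i, K (z i)) ->
  exists2 y, K y & forall (V : set T) m, nbhs y V -> exists2 i, (m <= i)%N & V (z i).
Proof.
move=> cK Kz; have [y [Ky cly]] : K `&` cluster (z @ \oo) !=set0.
  by apply: cK; exists 0%N => // i _ /=.
exists y => // V m Vy; have [w [[i /= mi <-] Vw]] : z @` [set i | (m <= i)%N] `&` V !=set0.
  by apply: cly => //; exists m => // i /= mi; exists i.
by exists i.
Qed.

Section NontrivialStableSet.
Context {R : realType} {M : topologicalType} {n : nat}.
Variables (f g : M -> M) (p : M) (phi : chart R M n) (N : set M) (H : 'M[R]_n) (c c' : R).
Hypotheses (adf : adapted f p phi N H c) (adg : adapted g p phi N (- H) c').
Hypotheses (cf : continuous f) (cg : continuous g) (gK : cancel g f).
Hypothesis cM : compact [set: M].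

Lemma iter_cancel i k x : (i <= k)%N -> iter i f (iter k g x) = iter (k - i) g x.
Proof.
elim: i k => [|i IH] [|k] //=; rewrite ltnS => ik.
by rewrite -[f (iter i f _)]iterS iterSr gK IH.
Qed.

(* Backward orbits starting close to p in the cone Q < 0 leave N; an
   accumulation point of their exit points stays in N forever in the future. *)
Lemma stable_set_nontrivial v : qform H v < 0 -> exists2 y, y <> p & stable_set f p y.
Proof.
move=> Hv.
(* [z m] is the last point in [N] before the first backward exit. By [~ N (g z)] the limit differs
   from the fixed point [p]; the long forward stay passes to the limit because [N] is closed. *)
have /choice[z Hz] : forall m, exists z, [/\ N z, ~ N (g z) &
    forall i, (i <= m)%N -> N (iter i f z)].
  move=> m; have cphi := adapted_chart adf.
  have ni i : nbhs p (iter i g @^-1` N).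
    apply: (iter_continuous (m := i) cg); rewrite (iter_fixed adg).
    exact: adapted_nbhs adg.
  have nm : nbhs p [set x | forall i, (i <= m)%N -> N (iter i g x)].
    elim: m => [|m IH]; first by apply: filterS (ni 0%N) => x Nx [].
    apply: filterS2 IH (ni m.+1) => x h Nx i.
    by rewrite leq_eqVlt => /predU1P[->//|]; apply: h.
  have Dp := adapted_dom adf (adapted_center adf).
  have [r r0 Hr] := chart_ballP cphi Dp nm.
  have v0 : v != 0.
    by apply: contraTneq Hv => ->; rewrite /qform /bform mul0mx mul0mx mxE ltxx.
  have nv : 0 < `|v| by rewrite normr_gt0.
  pose t := r / 2 / `|v|; have t0 : 0 < t by rewrite !divr_gt0.
  have [|Dx xE Nx] := Hr (phi p + t *: v).
    rewrite -ball_normE /= opprD addNKr normrN normrZ gtr0_norm // divfK ?gt_eqF //; lra.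
  set x := chart_inv phi _ in Dx xE Nx.
  have exk : exists k, ~~ `[< N (iter k g x) >].
    apply: contrapT => /forallNP h.
    have sx k : N (iter k g x) by have /negP := h k; rewrite negbK => /asboolP.
    have := stays_negative adg sx (stays_center adg).
    rewrite qformN xE [phi p + _]addrC addrK qformZ => h1.
    have c0 := adapted_gt0 adg.
    have : t ^+ 2 * qform H v < 0 by rewrite pmulr_rlt0 // exprn_gt0.
    have : 0 <= c' * `|t *: v| ^+ 2 by rewrite mulr_ge0 ?sqr_ge0 // ltW.
    lra.
  pose k := ex_minn exk; have Nk : ~ N (iter k g x).
    by rewrite /k; case: ex_minnP => l /negP h _ /asboolP.
  have kmin i : ~ N (iter i g x) -> (k <= i)%N.
    by move=> Ni; rewrite /k; case: ex_minnP => l _; apply; apply/negP => /asboolP.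
  have before i : (i < k)%N -> N (iter i g x).
    move=> ik; apply: contrapT => /kmin; rewrite leqNgt ik //.
  have km : (m < k)%N.
    by rewrite ltnNge; apply/negP => km; apply: Nk; apply: (Nx k).
  exists (iter k.-1 g x); split.
  - by apply: before; rewrite prednK // (leq_ltn_trans _ km).
  - by rewrite -iterS prednK // (leq_ltn_trans _ km).
  - move=> i im; rewrite iter_cancel; last by rewrite -ltnS prednK ?(leq_ltn_trans _ km) // (leq_ltn_trans im).
    apply: before; apply: (@leq_ltn_trans k.-1); first exact: leq_subr.
    by rewrite prednK // (leq_ltn_trans _ km).
have [y _ clz] := compact_accumulation cM (fun i => Logic.I : setT (z i)).
exists y.
  move=> yp; have nV : nbhs y (g @^-1` N).
    by apply: cg; rewrite yp (adapted_fixed adg); exact: adapted_nbhs adg.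
  by have [i _] := clz _ 0%N nV; have [_ h _] := Hz i => /h.
apply: (stays_stable adf) => k; apply: contrapT => Nk.
have nV : nbhs y (iter k f @^-1` ~` N).
  apply: (iter_continuous (m := k) cf); apply: open_nbhs_nbhs; split=> //.
  by apply: closed_openC; exact: adapted_closed adf.
have [i ki] := clz _ k nV; apply.
by have [_ _] := Hz i; apply.
Qed.

End NontrivialStableSet.

Section StableDimension.
Context {R : realType} {M : topologicalType} {n : nat} {A : set (chart R M n)}.
Hypothesis atlas : smooth_atlas A.

(** The tangent space found is at some [f^m (j u)] in [N], not at [p]. A whole parameter
    neighbourhood of [u] stays in [N] from the same time [m] on, so [stays_negative] applies to
    difference quotients, and its nonstrict bound survives the limit. *)
Lemma stable_set_tangent (f : diffeo A) p phi N H c k (j : 'rV[R]_k -> M) :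
  adapted f p phi N H c -> A phi -> immersed_copy A (Ws f p) j ->
  exists D : 'M[R]_(k, n), (forall v : 'rV[R]_k, v *m D = 0 -> v = 0) /\
    forall v : 'rV[R]_k, qform H (v *m D) <= - c * `|v *m D| ^+ 2.
Proof.
move=> ad Aphi ij; have [[cj _] _ _ rj] := ij.
have cf : continuous f := (diffeo_smooth f).1.
have cfj m : continuous (iter m f \o j).
  by move=> u; apply: (@continuous_comp _ _ _ j (iter m f) u); [exact: cj|exact: iter_continuous].
(* Parameters whose orbit is outside [N] at some time from [m] on, an open set since [N] is closed.
   Every point of the stable set eventually stays, so these sets have no common point and by Baire
   one of them is not dense. *)
pose F m := [set u : 'rV[R]_k | exists i, ~ N (iter i f (iter m f (j u)))].
have oF m : open (F m).
  have -> : F m = \bigcup_i ((iter (i + m) f \o j) @^-1` ~` N).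
    by apply/seteqP; split=> [u [i h]|u [i _ h]]; exists i; rewrite /= ?iterD // -iterD.
  apply: bigcup_open => i _; apply: open_comp => [u _|]; first exact: cfj.
  by apply: closed_openC; exact: adapted_closed ad.
have [m [G [[u Ou] oO sub]]] : exists m G, [/\ G !=set0, open G & G `&` F m = set0].
  apply: contrapT => h.
  have [m|u [_ Fu]] := @Baire R 'rV[R]_k F _ setT (ex_intro _ 0 Logic.I) openT.
    split; first exact: oF.
    move=> G O0 oO; apply: contrapT => /nonemptyPn e.
    by apply: h; exists m, G.
  have : Ws f p (j u) by rewrite -rj; exists u.
  move=> /(stable_eventually_stays ad)[m sm].
  by have [i Ni] := Fu m Logic.I; apply: Ni; apply: sm.
have Ost w : G w -> forall i, N (iter i f (iter m f (j w))).
  move=> Ow i; apply: contrapT => Ni.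
  have : (G `&` F m) w by split=> //; exists i.
  by rewrite sub.
pose h := phi \o (iter m f \o j).
have [dh injh] : differentiable h u /\ injective ('d h u : 'rV[R]_k -> 'rV[R]_n).
  have im := immersive_at_iter atlas (f := f) (m := m) cj (immersed_copy_immersive (u := u) ij).
  exact: (im phi Aphi (adapted_dom ad (Ost u Ou 0%N))).
exists ('J h u).
have JE v : v *m 'J h u = 'd h u v by rewrite /jacobian mul_rV_lin1.
split=> [v|v].
  by move=> e; apply: injh; rewrite -JE e linear0.
have dv : (fun t : R => t^-1 *: (h (t *: v + u) - h u)) @ 0^' --> v *m 'J h u.
  by rewrite -deriveEjacobian //; exact: diff_derivable.
pose q w := qform H w + c * `|w| ^+ 2.
suff : q (v *m 'J h u) <= 0 by rewrite /q; lra.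
rewrite leNgt; apply/negP => qpos.
have cq : {for v *m 'J h u, continuous (q : 'rV[R]_n -> R^o)}.
  apply: continuousD; first exact: qform_continuous.
  apply: continuousM; first exact: cst_continuous.
  rewrite (_ : (fun _ => _) = (fun x : R => x ^+ 2) \o (@Num.norm _ _)); last by [].
  apply: continuous_comp; first exact: norm_continuous.
  exact: exprn_continuous.
have cv := @cvg_comp _ _ _ _ q _ _ _ dv cq.
have nO : \forall t \near 0^', G (t *: v + u).
  have : (fun t : R => t *: v + u) @ 0^' --> u.
    rewrite -[X in _ --> X]add0r -[X in X + _](scale0r v).
    apply: cvgD; last exact: cvg_cst.
    apply: cvgZl; exact: (@cvg_within _ _ _).
  by apply; exact: open_nbhs_nbhs.
have qp : \forall t \near 0^', 0 < q (t^-1 *: (h (t *: v + u) - h u)).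
  by move/cvgr_gt: cv => /(_ _ qpos).
have [t [tO qt]] := filter_ex (filterI nO qp).
move: qt; rewrite /q qformZ normrZ exprMn real_normK ?num_real //.
have := stays_negative ad (Ost _ tO) (Ost _ Ou); rewrite -/(h _) -/(h u).
set d := _ - h u => hd.
have -> : t^-1 ^+ 2 * qform H d + c * (t^-1 ^+ 2 * `|d| ^+ 2) =
  t^-1 ^+ 2 * (qform H d + c * `|d| ^+ 2) by ring.
apply/negP; rewrite -leNgt mulr_ge0_le0 ?sqr_ge0 //; lra.
Qed.

End StableDimension.

(** * Thin subsets of the manifold and types of fixed points *)

Definition diffeoV (R : realType) (M : topologicalType) n (A : set (chart R M n))
    (f : diffeo A) : diffeo A :=
  Diffeo (diffeo_inv_smooth f) (diffeo_smooth f) (diffeo_invK f) (diffeo_funK f).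

Section ThinInManifold.
Context {R : realType} {M : topologicalType} {n : nat} {A : set (chart R M n)}.

Lemma box_dim_le_leq k m (S : set 'rV[R]_n) : (k <= m)%N -> box_dim_le k S -> box_dim_le m S.
Proof.
move=> km [C HC]; exists C => K; have [s sz Hs] := HC K; exists s => //.
by apply: leq_trans sz _; rewrite leq_mul2l leq_pexp2l // orbT.
Qed.

Lemma thin_leq k m (S : set 'rV[R]_n) : (k <= m)%N -> thin k S -> thin m S.
Proof.
by move=> km [I [S' [HS h]]]; exists I, S'; split=> // i; apply: box_dim_le_leq (HS i).
Qed.

Lemma thin1 m (x : 'rV[R]_n) : thin m [set x].
Proof.
exists unit, (fun _ => [set x]); split=> [_|y ->]; last by exists tt.
exists 1%N => K; exists [:: x]; first by rewrite mul1n expn_gt0.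
by move=> y ->; exists x; rewrite ?inE // subrr normr0 invr_ge0.
Qed.

Definition thin_in (m : nat) (W : set M) :=
  forall phi, A phi -> thin m (phi @` (W `&` chart_dom phi)).

Lemma immersed_copy_thin k W (j : 'rV[R]_k -> M) : smooth_atlas A ->
  immersed_copy A W j -> thin_in k W.
Proof.
move=> atlas [sj _ _ <-] phi Aphi; have [cj _] := sj.
have [oD _ _ _ _] := atlas_chart atlas Aphi.
have oU : open (j @^-1` chart_dom phi) by apply: open_comp => // u _; exact: cj.
apply: thin_sub (thin_smooth_image oU (immersed_copy_smooth_on sj Aphi)).
by move=> _ [_ [[u _ <-] Du] <-]; exists u.
Qed.

Lemma thin_in1 m (p : M) : thin_in m [set p].
Proof.
move=> phi _; apply: thin_sub (thin1 m (phi p)).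
by move=> _ [_ [-> _] <-].
Qed.

Lemma thin_in_leq k m W : (k <= m)%N -> thin_in k W -> thin_in m W.
Proof. by move=> km h phi Aphi; apply: thin_leq (h _ Aphi). Qed.

Lemma thin_in_bigcup (I : Type) (D : set I) m (W : I -> set M) : finite_set D ->
  (forall i, D i -> thin_in m (W i)) -> thin_in m (\bigcup_(i in D) W i).
Proof.
move=> fD tW phi Aphi.
have [s Ds] : exists s : seq {classic I}, D = [set` s] by exact/finite_seqP.
have : forall s : seq {classic I}, (forall i, i \in s -> thin_in m (W i)) ->
    thin m (phi @` ((\bigcup_(i in [set` s]) W i) `&` chart_dom phi)).
  elim=> [_|a t IH h].
    by apply: thin_sub (thin1 m 0) => _ [_ [[? //]]].
  have h1 := h a (mem_head _ _) phi Aphi.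
  have h2 : thin m (phi @` ((\bigcup_(i in [set` t]) W i) `&` chart_dom phi)).
    by apply: IH => i it; apply: h; rewrite inE it orbT.
  apply: thin_sub (thinU h1 h2) => _ [x [[i /= ii Wx] Dx] <-].
  move: ii; rewrite inE => /orP[/eqP ia|it]; first by left; exists x => //; split=> //; rewrite -ia.
  by right; exists x => //; split=> //; exists i.
by rewrite Ds; apply => i is_; apply: tW; rewrite Ds.
Qed.

Lemma thin_in_avoid m W V : smooth_atlas A -> (m < n)%N -> thin_in m W ->
  open V -> V !=set0 -> exists2 x, V x & ~ W x.
Proof.
move=> atlas mn tW oV [x Vx]; have [_ cov _] := atlas.
have [phi Aphi Dx] := cov x; have cphi := atlas_chart atlas Aphi.
have [r r0 Hr] := chart_ballP cphi Dx (open_nbhs_nbhs (conj oV Vx)).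
have [u ru Wu] := thin_avoid mn (tW phi Aphi) (ball_open (phi x) r)
  (ex_intro _ (phi x) (ballxx _ r0)).
have [Du uE Vu] := Hr u ru; exists (chart_inv phi u) => // Wx.
by apply: Wu; exists (chart_inv phi u).
Qed.

End ThinInManifold.

Section FixedPointTypes.
Context {R : realType} {M : topologicalType} {n : nat} {A : set (chart R M n)}.
Implicit Types (f : diffeo A) (p : M).

Definition adapted_pair f p := exists phi N H c c',
  [/\ A phi, adapted f p phi N H c & adapted (diffeo_inv f) p phi N (- H) c'].

(** All that the global part of the argument retains of a sink. *)
Definition attractor f p := f p = p /\ forall V, nbhs p V ->
  exists S : set M, [/\ open S, S p, S `<=` V, f @` S `<=` S & S `<=` Ws f p].

Lemma adapted_pairV f p : adapted_pair f p -> adapted_pair (diffeoV f) p.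
Proof.
move=> [phi [N [H [c [c' [Aphi adf adg]]]]]].
by exists phi, N, (- H), c', c; split=> //; rewrite opprK.
Qed.

Hypothesis closedM : closed_smooth_manifold A.

Let atlas : smooth_atlas A. Proof. by case: closedM. Qed.

Lemma diffeo_continuous f : continuous f.
Proof. exact: (diffeo_smooth f).1. Qed.

(** In full dimension the tangent matrix [D] is invertible, so the form is nonpositive on the whole
    space, and its opposite makes [p] repelling for the inverse. *)
Lemma attractor_of_dim f p : adapted_pair f p -> has_dim A (Ws f p) n ->
  attractor f p /\ Wu f p = [set p].
Proof.
move=> [phi [N [H [c [c' [Aphi adf adg]]]]]] [j ij].
have [D [Dinj HD]] := stable_set_tangent atlas adf Aphi ij.
have uD : D \in unitmx.
  rewrite -row_free_unit -kermx_eq0; apply/eqP/row_matrixP => i.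
  by rewrite row0; apply: Dinj; rewrite -row_mul mulmx_ker row0.
have c0 := adapted_gt0 adf.
have H0 v : qform H v <= 0.
  rewrite -[v](mulmxKV uD); apply: le_trans (HD _) _.
  by rewrite mulNr oppr_le0 mulr_ge0 ?sqr_ge0 // ltW.
split.
  split; first exact: adapted_fixed adf.
  move=> V nV; exact: (attracting_nbhs adf (@diffeo_continuous f) H0 nV).
apply/seteqP; split=> [x Wx|_ ->].
  apply: (repelling_stable_set adg) Wx; first exact: can_inj (diffeo_invK f).
  by move=> v; rewrite qformN oppr_ge0.
exact: (stays_stable adg (stays_center adg)).
Qed.

(** The two tangent spaces may sit at different points of [M], but both are read in the chart, where
    the same form is negative definite on one and positive definite on the other. If [k + l > n],
    the stacked matrix would have a nonzero kernel vector, hence a common nonzero vector of both. *)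
Lemma stable_unstable_dim f p k l : adapted_pair f p ->
  has_dim A (Ws f p) k -> has_dim A (Wu f p) l -> (k + l <= n)%N.
Proof.
move=> [phi [N [H [c [c' [Aphi adf adg]]]]]] [js ijs] [ju iju].
have [D [Dinj HD]] := stable_set_tangent atlas adf Aphi ijs.
have [E [Einj HE]] := stable_set_tangent atlas (f := diffeoV f) adg Aphi iju.
rewrite leqNgt; apply/negP => nkl.
have : kermx (col_mx D E) != 0.
  rewrite kermx_eq0 /row_free; apply: contraTneq nkl => <-.
  by rewrite -leqNgt rank_leq_col.
move=> /eqP; apply; apply/row_matrixP => i; rewrite row0.
have : row i (kermx (col_mx D E)) *m col_mx D E = 0.
  by rewrite -row_mul mulmx_ker row0.
set w := row i _; rewrite -[w]hsubmxK mul_row_col.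
set v1 := lsubmx w; set v2 := rsubmx w => /eqP; rewrite addr_eq0 => /eqP e.
have c0 := adapted_gt0 adf; have c'0 := adapted_gt0 adg.
have hD := HD v1; have hE := HE (- v2).
rewrite qformN mulNmx -e in hE.
have z : v1 *m D = 0.
  apply/eqP; rewrite -normr_eq0 -sqrf_eq0 eq_le sqr_ge0 andbT.
  rewrite -(pmulr_rle0 _ (addr_gt0 c0 c'0)); lra.
rewrite (Dinj _ z) (Einj v2); first by rewrite row_mx0.
by apply/eqP; rewrite -oppr_eq0 -e z.
Qed.

(** If the form has no negative value, [p] attracts a neighbourhood under the inverse, and its
    unstable set would contain an open set in spite of having dimension [l < n]. *)
Lemma stable_set_neq1 f p l : adapted_pair f p -> has_dim A (Wu f p) l -> (l < n)%N ->
  exists2 y, y <> p & Ws f p y.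
Proof.
move=> [phi [N [H [c [c' [Aphi adf adg]]]]]] [ju iju] ln.
have [_ _ cM _] := closedM.
have [[v Hv]|Hpos] := pselect (exists v, qform H v < 0).
  exact: (stable_set_nontrivial adf adg (@diffeo_continuous f)
    (diffeo_inv_smooth f).1 (diffeo_invK f) cM Hv).
have H0 v : qform (- H) v <= 0.
  by rewrite qformN oppr_le0 leNgt; apply/negP => Hv; apply: Hpos; exists v.
have [S [oS Sp _ _ SW]] := attracting_nbhs adg (diffeo_inv_smooth f).1 H0 (@filterT _ (nbhs p) _).
have [x Sx] := thin_in_avoid atlas ln (immersed_copy_thin atlas iju) oS (ex_intro _ p Sp).
by case; apply: SW.
Qed.

Lemma has_dim0_eq (W : set M) x y : has_dim A W 0 -> W x -> W y -> x = y.
Proof.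
move=> [j [_ _ _ <-]] [u _ <-] [v _ <-].
by congr (j _); apply/rowP => -[].
Qed.

Lemma fixed_stable f p : f p = p -> Ws f p p.
Proof.
move=> fp; rewrite /Ws /stable_set /= (_ : (fun k => iter k f p) = fun=> p); first exact: cvg_cst.
by apply/funext => k; elim: k => //= k ->.
Qed.

(** A zero-dimensional stable set would be one point, so both dimensions are at least 1. Their sum
    is at most [n], so a dimension above [n - 2] equals [n - 1] and forces the other to be 1. *)
Lemma saddle_thin f p k : (2 <= n)%N -> adapted_pair f p -> saddle f p -> has_dim A (Ws f p) k ->
  ~ codimension_one_saddle f p ->
  thin_in (A := A) (n - 2) (Ws f p) /\ thin_in (A := A) (n - 2) (Wu f p).
Proof.
move=> n2 ap sp dk ncod; have [[fp _] [l dl /andP[l1 ln]]] := sp.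
have kl := stable_unstable_dim ap dk dl.
have k1 : (0 < k)%N.
  rewrite lt0n; apply/eqP => k0; rewrite k0 in dk.
  have [|y yp Wy] := stable_set_neq1 ap dl; first lia.
  by apply: yp; apply: has_dim0_eq Wy (fixed_stable fp).
have kn : (k <= n - 2)%N.
  rewrite leqNgt; apply/negP => kn; apply: ncod; split=> //; left.
  have [kE lE] : k = n.-1 /\ l = 1%N by lia.
by rewrite -kE; split=> //; rewrite -lE.
have lnn : (l <= n - 2)%N.
  rewrite leqNgt; apply/negP => ln'; apply: ncod; split=> //; right.
  have [lE kE] : l = n.-1 /\ k = 1%N by lia.
  by rewrite -lE; split=> //; rewrite -kE.
have [js ijs] := dk; have [ju iju] := dl.
by split; [apply: thin_in_leq (immersed_copy_thin atlas ijs)|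
  apply: thin_in_leq (immersed_copy_thin atlas iju)].
Qed.

End FixedPointTypes.
(** * Attractors and their basins *)

Section OmegaLimits.
Context {R : realType} {M : topologicalType} {n : nat} {A : set (chart R M n)}.

Lemma accumulation_nonwandering (f : diffeo A) x (z : nat -> nat) y :
  (forall m, (m <= z m)%N) ->
  (forall (V : set M) m, nbhs y V -> exists2 i, (m <= i)%N & V (iter (z i) f x)) ->
  nonwandering f y.
Proof.
move=> zm yz U oU Uy; have nU : nbhs y U by exact: open_nbhs_nbhs.
have [i _ Ui] := yz U 0%N nU; have [j ij Uj] := yz U (z i).+1 nU.
have zij : (z i < z j)%N by apply: leq_trans ij (zm j).
exists (z j - z i)%N; first by rewrite subn_gt0.
exists (iter (z j) f x); split=> //; exists (iter (z i) f x) => //.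
by rewrite -iterD subnK // ltnW.
Qed.

(** Otherwise the orbit would leave some small neighbourhood [G] of its accumulation point [p]
    infinitely often. The points of departure accumulate at a nonwandering point of the closure,
    which can only be [p]; but [p] is fixed, so points near it are mapped into [G]. *)
Lemma stable_sets_cover (f : diffeo A) x : hausdorff_space M -> compact [set: M] ->
  finite_set (nonwandering f) -> (forall p, nonwandering f p -> f p = p) ->
  exists2 p, nonwandering f p & Ws f p x.
Proof.
move=> hM cM fNW fixNW; have cf : continuous f := (diffeo_smooth f).1.
have [p _ clp] := compact_accumulation cM (fun k => Logic.I : setT (iter k f x)).
have NWp : nonwandering f p by apply: (@accumulation_nonwandering f x id).
exists p => // V nV.
have cl1 : closed (nonwandering f `\ p).
  have [h _] := @accessible_finite_set_closed M.
  by apply: (h (hausdorff_accessible hM)); exact: finite_setD.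
have nW : nbhs p (V `&` ~` (nonwandering f `\ p)).
  apply: filterI => //; apply: open_nbhs_nbhs; split; first exact: closed_openC.
  by move=> [_]; apply.
have [B nB clB] := @compact_regular M p setT hM cM filterT _ nW.
pose G := B° `&` V°.
have [m Hm] : exists m, forall k, (m <= k)%N -> G (iter k f x) -> G (iter k.+1 f x).
  apply: contrapT => /forallNP h.
  have /choice[z Hz] : forall m, exists k, [/\ (m <= k)%N, G (iter k f x) & ~ G (iter k.+1 f x)].
    move=> m; apply: contrapT => h'; apply: (h m) => k mk Gk.
    by apply: contrapT => nG; apply: h'; exists k.
  have [y _ cly] := compact_accumulation cM (fun m => Logic.I : setT (iter (z m) f x)).
  have NWy : nonwandering f y.
    by apply: (accumulation_nonwandering _ cly) => m; have [] := Hz m.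
  have By : closure B y.
    move=> C nC; have [i _ Ci] := cly C 0%N nC; exists (iter (z i) f x); split=> //.
    by have [_ [/interior_subset]] := Hz i.
  have yp : y = p.
    by apply: contrapT => yp; have [_] := clB _ By; apply; split.
  have nfG : nbhs y (f @^-1` G).
    apply: cf; rewrite (fixNW _ NWy) yp; apply: filterI; exact: nbhs_interior.
  by have [i _ Gi] := cly _ 0%N nfG; have [_ _] := Hz i; apply.
have nG : nbhs p G by apply: filterI; exact: nbhs_interior.
have [k mk Gk] := clp G m nG.
exists k => // i /= ki.
suff [_ /interior_subset] : G (iter i f x) by [].
rewrite -(subnK ki); elim: (i - k)%N => [//|d IH].
by apply: Hm => //; rewrite (leq_trans mk) // leq_addl.
Qed.

End OmegaLimits.

Section Clamp.
Context {R : realType}.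

(** Retraction onto the unit interval: composing with it gives paths and homotopies continuous on
    the whole line or plane, without subspace topologies. *)
Definition clamp01 (t : R) : R := Num.max 0 (Num.min t 1).

Lemma clamp01_ge0 t : 0 <= clamp01 t.
Proof. by rewrite le_max lexx. Qed.

Lemma clamp01_le1 t : clamp01 t <= 1.
Proof. by rewrite ge_max ler01 ge_min lexx orbT. Qed.

Lemma clamp01_id t : 0 <= t <= 1 -> clamp01 t = t.
Proof. by move=> /andP[t0 t1]; rewrite /clamp01 (min_l t1) (max_r t0). Qed.

Lemma clamp01_continuous : continuous (clamp01 : R -> R).
Proof.
move=> t; apply: (@continuous_max R R (fun _ => 0) (fun t => Num.min t 1)).
  exact: cst_continuous.
apply: (@continuous_min R R id (fun _ => 1)); [exact: cvg_id|exact: cst_continuous].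
Qed.

Lemma comp_clamp01_continuous (T : topologicalType) (g : T -> R) :
  continuous g -> continuous (fun x => clamp01 (g x)).
Proof.
move=> cg x; apply: (@continuous_comp _ _ _ g clamp01); first exact: cg.
exact: clamp01_continuous.
Qed.

End Clamp.

Section ChartBalls.
Context {R : realType} {M : topologicalType} {n : nat} {A : set (chart R M n)}.
Implicit Types (phi : chart R M n).

Definition chart_ball phi (x : M) (r : R) : set M :=
  [set y | chart_dom phi y /\ ball (phi x) r (phi y)].

Definition round phi (x : M) (r : R) := [/\ is_chart phi, chart_dom phi x, 0 < r &
  forall u, ball (phi x) r u -> chart_dom phi (chart_inv phi u) /\ phi (chart_inv phi u) = u].

Lemma round_le phi x r s : round phi x r -> 0 < s -> s <= r -> round phi x s.
Proof. by move=> [? ? _ h] s0 sr; split=> // u /(le_ball sr); apply: h. Qed.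

Lemma round_open phi x r : round phi x r -> open (chart_ball phi x r).
Proof.
move=> [ch Dx r0 h]; have [oD _ _ _ _] := ch.
rewrite openE => y [Dy by_]; apply: filterI; first exact: open_nbhs_nbhs.
apply: (chart_continuous ch Dy); apply: open_nbhs_nbhs; split=> //.
exact: ball_open.
Qed.

Lemma chart_ball_center phi x r : round phi x r -> chart_ball phi x r x.
Proof. by move=> [_ Dx r0 _]; split=> //; exact: ballxx. Qed.

Lemma chart_ball_inv phi x r u : round phi x r -> ball (phi x) r u ->
  chart_ball phi x r (chart_inv phi u).
Proof. by move=> [_ _ _ h] bu; have [Du uE] := h u bu; split=> //; rewrite uE. Qed.

Lemma chart_inv_comp_continuous phi x r (T : topologicalType) (g : T -> 'rV[R]_n) :
  round phi x r -> continuous g -> (forall t, ball (phi x) r (g t)) ->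
  continuous (chart_inv phi \o g).
Proof.
move=> [ch _ _ h] cg gb t; apply: (@continuous_comp _ _ _ g (chart_inv phi)).
  exact: cg.
apply: (chart_inv_continuous ch); have [Du uE] := h _ (gb t).
by exists (chart_inv phi (g t)).
Qed.

Lemma exists_round phi x V : is_chart phi -> chart_dom phi x -> nbhs x V ->
  exists r, round phi x r /\ chart_ball phi x r `<=` V.
Proof.
move=> ch Dx nV; have [r r0 Hr] := chart_ballP ch Dx nV; have [_ _ K _ _] := ch.
exists r; split; first by split=> // u /Hr[].
by move=> y [Dy /Hr[_ _]]; rewrite K.
Qed.

Lemma scale_line_continuous (T : topologicalType) (s : T -> R) (v : 'rV[R]_n) :
  continuous s -> continuous (fun t => s t *: v).
Proof. by move=> cs t; apply: cvgZl; exact: cs. Qed.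

(* A generic broken segment in the chart avoids W, since the cone over W from
   either end has codimension at least one. *)
Lemma path_avoiding phi x r W y z : A phi -> round phi x r -> (2 <= n)%N ->
  thin_in (A := A) (n - 2) W ->
  chart_ball phi x r y -> ~ W y -> chart_ball phi x r z -> ~ W z ->
  exists gam : R -> M, [/\ continuous gam, gam 0 = y, gam 1 = z &
    forall t, chart_ball phi x r (gam t) /\ ~ W (gam t)].
Proof.
move=> Aphi rd n2 tW [Dy byy] Wy [Dz bz] Wz; have [ch Dx r0 h] := rd.
have [_ _ K _ _] := ch.
have nW y' : chart_dom phi y' -> ~ W y' -> ~ (phi @` (W `&` chart_dom phi)) (phi y').
  by move=> Dy' Wy' [w [Ww Dw] e]; apply: Wy'; rewrite -(K y') // -e K.
have [|w bw Hw] := thin_segments (phi x) (r := r) _ (tW phi Aphi) r0 (nW y Dy Wy) (nW z Dz Wz).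
  lia.
pose s1 (t : R) := clamp01 (2 * t); pose s2 (t : R) := clamp01 (2 * t - 1).
(* One formula for both legs: [s2] vanishes up to time 1/2, and [s1] equals 1 from then on. *)
pose g t := phi y + s1 t *: (w - phi y) + s2 t *: (phi z - w).
have gE t : (exists2 s, 0 <= s <= 1 & g t = phi y + s *: (w - phi y)) \/
            (exists2 s, 0 <= s <= 1 & g t = w + s *: (phi z - w)).
  have [th|th] := leP (2 * t) 1.
    left; exists (s1 t); first by rewrite clamp01_ge0 clamp01_le1.
    have -> : g t = phi y + s1 t *: (w - phi y) + s2 t *: (phi z - w) by [].
    by rewrite /s2 /clamp01 min_l ?max_l ?scale0r ?addr0 //; lra.
  right; exists (s2 t); first by rewrite clamp01_ge0 clamp01_le1.
  by rewrite /g /s1 /clamp01 min_r ?max_r ?scale1r ?subrKC //; lra.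
have cg : continuous g.
  have c2 : continuous (fun t : R => 2 * t) by move=> t; apply: cvgM; [exact: cvg_cst|exact: cvg_id].
  have c1 : continuous s1 by apply: comp_clamp01_continuous.
  have c3 : continuous s2.
    by apply: comp_clamp01_continuous => t; apply: cvgB; [exact: c2|exact: cvg_cst].
  move=> t; apply: cvgD; last exact: scale_line_continuous.
  by apply: cvgD; [exact: cvg_cst|exact: scale_line_continuous].
have gb t : ball (phi x) r (g t) /\ ~ (phi @` (W `&` chart_dom phi)) (g t).
  have [[s s01 ->]|[s s01 ->]] := gE t; split.
  - exact: ball_convex.
  - exact: (Hw s s01).1.
  - exact: ball_convex.
  - exact: (Hw s s01).2.
exists (chart_inv phi \o g); split.
- by apply: (chart_inv_comp_continuous rd cg) => t; have [] := gb t.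
- rewrite /= /g /s1 /s2 mulr0 sub0r /clamp01 min_l ?ler01 // maxxx min_l; last lra.
  by rewrite max_l ?lerN10 // !scale0r !addr0 K.
- rewrite /= /g /s1 /s2 mulr1 /clamp01 min_r; last lra.
  by rewrite min_r ?max_r ?ler01 ?scale1r ?subrKC ?K //; lra.
- move=> t; have [gbt Wt] := gb t; split; first exact: chart_ball_inv.
  have [Du uE] := h _ gbt.
  by move=> Wg; apply: Wt; exists (chart_inv phi (g t)).
Qed.

End ChartBalls.

Section UniqueAttractor.
Context {R : realType} {M : topologicalType} {n : nat} {A : set (chart R M n)}.
Hypothesis closedM : closed_smooth_manifold A.
Hypothesis n2 : (2 <= n)%N.

Let atlas : smooth_atlas A. Proof. by case: closedM. Qed.
Let hM : hausdorff_space M. Proof. by case: closedM. Qed.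

Lemma attractor_basin_open (f : diffeo A) p : attractor f p -> open (Ws f p).
Proof.
move=> [fp at_p]; have [S [oS Sp _ Sf SW]] := at_p setT filterT.
have -> : Ws f p = \bigcup_k (iter k f @^-1` S).
  apply/seteqP; split=> [x /(_ S (open_nbhs_nbhs (conj oS Sp)))[k _ Sk]|x [k _ Sk]].
    by exists k => //; exact: (Sk k (leqnn k)).
  have /SW : S (iter k f x) by [].
  move=> h V nV; have [m _ Hm] := h V nV; exists (m + k)%N => // i /= mki.
  have ki : (k <= i)%N by exact: leq_trans (leq_addl m k) mki.
  by rewrite -(subnK ki) iterD; apply: Hm; rewrite /= leq_subRL // addnC.
apply: bigcup_open => k _; apply: open_comp => // x _.
exact: (iter_continuous (m := k) (diffeo_smooth f).1).
Qed.

Lemma stable_set_unique (f : diffeo A) p q x : Ws f p x -> Ws f q x -> p = q.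
Proof. by move=> px qx; exact: (cvg_unique hM px qx). Qed.

Lemma connected_partition (T : topologicalType) (I : Type) (U : I -> set T) (x y : T) i j :
  connected [set: T] -> (forall k, open (U k)) -> (forall z, exists k, U k z) ->
  (forall k l z, U k z -> U l z -> k = l) -> U i x -> U j y -> i = j.
Proof.
move=> cT oU covU disU Ux Uy.
suff Ui : U i = setT by apply: (disU _ _ y) => //; rewrite Ui.
apply: cT; first by exists x.
- by exists (U i); rewrite ?setTI.
- exists (U i); rewrite ?setTI // -openC.
  have -> : ~` U i = \bigcup_(k in [set k | k <> i]) U k.
    apply/seteqP; split=> [z nz|z [k /= ki Uk Ui]]; last by apply: ki; exact: disU Uk Ui.
    have [k Uk] := covU z; exists k => //= ki; by rewrite ki in Uk.
  by apply: bigcup_open => k _.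
Qed.

Lemma connected_realline : connected [set: R].
Proof. by apply/connected_intervalP => a b _ _ c _. Qed.

(** Connectedness of [M] is applied to the sets [L p] of points near which everything off [W] lies
    in the basin of [p]. They cover [M], since a path off [W] in a chart ball cannot pass between
    disjoint open basins, and they are disjoint, since [W] contains no open set. *)
Lemma unique_attractor (f : diffeo A) (x0 : M) : connected [set: M] ->
  finite_set (nonwandering f) ->
  (forall p, nonwandering f p -> f p = p /\
     (attractor f p \/ thin_in (A := A) (n - 2) (Ws f p))) ->
  exists p W, [/\ attractor f p, thin_in (A := A) (n - 2) W,
    forall x, ~ W x -> Ws f p x & forall q, attractor f q -> q = p].
Proof.
move=> cM fNW tNW; have [_ _ compM _] := closedM; have [_ cov _] := atlas.
pose D := [set p | nonwandering f p /\ thin_in (A := A) (n - 2) (Ws f p)].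
pose W := \bigcup_(p in D) Ws f p.
have tW : thin_in (A := A) (n - 2) W.
  apply: thin_in_bigcup => [|p [] //].
  by apply: sub_finite_set fNW => p [].
have basin x : ~ W x -> exists2 p, attractor f p & Ws f p x.
  move=> Wx; have [p NWp px] := stable_sets_cover x hM compM fNW (fun p h => (tNW p h).1).
  have [_ [ap|tp]] := tNW p NWp; first by exists p.
  by case: Wx; exists p.
pose P := {p | attractor f p}.
pose L (p : P) := [set x | exists V, [/\ open V, V x & V `\` W `<=` Ws f (sval p)]].
have nn : (n - 2 < n)%N by lia.
have oL p : open (L p).
  rewrite openE => x [V [oV Vx VW]]; apply: filterS (open_nbhs_nbhs (conj oV Vx)) => y Vy.
  by exists V.
have covL x : exists p, L p x.
  have [phi Aphi Dx] := cov x.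
  have [r [rd _]] := exists_round (atlas_chart atlas Aphi) Dx filterT.
  have oV := round_open rd; have Vx := chart_ball_center rd.
  have [y Vy Wy] := thin_in_avoid atlas nn tW oV (ex_intro _ x Vx).
  have [p ap py] := basin y Wy; exists (exist _ p ap), (chart_ball phi x r); split=> // z [Vz Wz].
  have [gam [cg g0 g1 gV]] := path_avoiding Aphi rd n2 tW Vy Wy Vz Wz.
  have [q aq qz] := basin z Wz.
  suff -> : exist _ p ap = exist _ q aq :> P by [].
  apply: (@connected_partition R P (fun k => gam @^-1` Ws f (sval k)) 0 1) => //=.
  - exact: connected_realline.
  - move=> [k ak] /=; apply: open_comp => [t _|]; first exact: cg.
    exact: attractor_basin_open.
  - by move=> t; have [_ /basin[k ak kt]] := gV t; exists (exist _ k ak).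
  - by move=> [k ak] [l al] t kt lt; apply: eq_exist; exact: stable_set_unique kt lt.
  - by rewrite g0.
  - by rewrite g1.
have disL (p q : P) x : L p x -> L q x -> p = q.
  case: p q => [p ap] [q aq] [V [oV Vx VW]] [V' [oV' V'x V'W]].
  have [y [Vy V'y] Wy] := thin_in_avoid atlas nn tW (openI oV oV') (ex_intro _ x (conj Vx V'x)).
  by apply: eq_exist; apply: (@stable_set_unique f _ _ y); [apply: VW|apply: V'W].
have [p Lp] := covL x0.
have pW x : ~ W x -> Ws f (sval p) x.
  move=> Wx; have [q Lq] := covL x.
  rewrite (connected_partition cM oL covL disL Lp Lq).
  by case: Lq => V [_ Vx VW]; apply: VW.
exists (sval p), W; split=> // [|q aq]; first exact: svalP.
have [y qy Wy] := thin_in_avoid atlas nn tW (attractor_basin_open aq)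
  (ex_intro _ q (fixed_stable aq.1)).
exact: stable_set_unique qy (pW y Wy).
Qed.

End UniqueAttractor.
(** * Null homotopies *)

Section Gluing.
Context {R : realType}.

Lemma glue_continuous (S T : topologicalType) (h : S -> R) (F G : S -> T) :
  continuous h -> continuous F -> continuous G -> (forall x, h x = 0 -> F x = G x) ->
  continuous (fun x => if h x <= 0 then F x else G x).
Proof.
move=> ch cF cG FG x; have [hx|hx|hx] := ltgtP (h x) 0.
- have near_lt : \forall y \near x, h y < 0 by move/cvgr_lt: (ch x) => /(_ _ hx).
  move=> V /= nV; have := cF x V; rewrite (ltW hx) in nV * => /(_ nV).
  by apply: filterS2 near_lt => y hy Vy; rewrite /= (ltW hy).
- have near_gt : \forall y \near x, 0 < h y by move/cvgr_gt: (ch x) => /(_ _ hx).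
  move=> V /= nV; have := cG x V; rewrite leNgt hx /= in nV * => /(_ nV).
  by apply: filterS2 near_gt => y hy Vy; rewrite /= leNgt hy.
- move=> V /= nV; rewrite hx lexx in nV.
  have nF : nbhs x (F @^-1` V) by exact: cF.
  have nG : nbhs x (G @^-1` V) by apply: cG; rewrite -FG.
  by apply: filterS2 nF nG => y Fy Gy /=; case: ifP.
Qed.

Lemma within01_continuous (T : topologicalType) (gam : R -> T) :
  {within `[0, 1], continuous gam} -> continuous (fun t => gam (clamp01 t)).
Proof.
move=> /subspace_continuousP cg t V nV.
have It : `[0, 1]%classic (clamp01 t) by rewrite /= in_itv /= clamp01_ge0 clamp01_le1.
have : \forall s \near t, `[0, 1]%classic (clamp01 s) -> V (gam (clamp01 s)).
  exact: (clamp01_continuous (cg _ It V nV)).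
move=> h; apply: filterS h => s; apply.
by rewrite /= in_itv /= clamp01_ge0 clamp01_le1.
Qed.

Lemma pair_continuous (S T U : topologicalType) (a : S -> T) (b : S -> U) :
  continuous a -> continuous b -> continuous (fun x => (a x, b x)).
Proof. by move=> ca cb x; apply: (cvg_pair (ca x) (cb x)). Qed.

End Gluing.

Section Cells.
Context {R : realType} {M : topologicalType} {n : nat} {A : set (chart R M n)}.
Implicit Types (phi : chart R M n).

Lemma chart_ball_continuous phi x r (T : topologicalType) (g : T -> M) :
  round phi x r -> continuous g -> (forall t, chart_dom phi (g t)) -> continuous (phi \o g).
Proof.
move=> [ch _ _ _] cg gD t; apply: (@continuous_comp _ _ _ g phi); first exact: cg.
exact: chart_continuous.
Qed.

(* Coons patch: a sum of three convex combinations, two with sign plus and one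
   with sign minus, whence the factor 3 on the radius. *)
Lemma coons_patch phi x r (b d l e : R -> M) :
  round phi x (3 * r) -> 0 < r ->
  continuous b -> continuous d -> continuous l -> continuous e ->
  (forall u, 0 <= u <= 1 -> chart_ball phi x r (b u)) ->
  (forall u, 0 <= u <= 1 -> chart_ball phi x r (d u)) ->
  (forall u, 0 <= u <= 1 -> chart_ball phi x r (l u)) ->
  (forall u, 0 <= u <= 1 -> chart_ball phi x r (e u)) ->
  b 0 = l 0 -> b 1 = e 0 -> d 0 = l 1 -> d 1 = e 1 ->
  exists G : R * R -> M, [/\ continuous G,
    forall u, G (u, 0) = b (clamp01 u), forall u, G (u, 1) = d (clamp01 u),
    forall s, G (0, s) = l (clamp01 s) & forall s, G (1, s) = e (clamp01 s)].
Proof.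
move=> rd r0 cb cd cl ce bV dV lV eV b0 b1 d0 d1.
have [ch Dx _ Hr] := rd; have [_ _ K _ _] := ch.
have I01 (t : R) : 0 <= clamp01 t <= 1 by rewrite clamp01_ge0 clamp01_le1.
pose u (z : R * R) := clamp01 z.1; pose s (z : R * R) := clamp01 z.2.
have cu : continuous u by apply: comp_clamp01_continuous => z; exact: cvg_fst.
have cs : continuous s by apply: comp_clamp01_continuous => z; exact: cvg_snd.
have chart_arc (g : R -> M) (w : R * R -> R) : continuous g -> continuous w ->
    (forall t, 0 <= t <= 1 -> chart_ball phi x r (g t)) ->
    (forall z, 0 <= w z <= 1) -> continuous (fun z => phi (g (w z))).
  move=> cg cw gV w01; apply: (chart_ball_continuous (g := g \o w) rd).
    by move=> z; apply: (@continuous_comp _ _ _ w g); [exact: cw|exact: cg].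
  by move=> z; have [] := gV _ (w01 z).
have u01 z : 0 <= u z <= 1 by exact: I01.
have s01 z : 0 <= s z <= 1 by exact: I01.
pose E z := (phi (b (u z)) + s z *: (phi (d (u z)) - phi (b (u z)))) +
  (phi (l (s z)) + u z *: (phi (e (s z)) - phi (l (s z)))) -
  ((phi (b 0) + u z *: (phi (b 1) - phi (b 0))) +
   s z *: ((phi (d 0) + u z *: (phi (d 1) - phi (d 0))) -
           (phi (b 0) + u z *: (phi (b 1) - phi (b 0))))).
have segc (p q : R * R -> 'rV[R]_n) (w : R * R -> R) : continuous p -> continuous q -> continuous w ->
    continuous (fun z => p z + w z *: (q z - p z)).
  move=> cp cq cw z; apply: cvgD; first exact: cp.
  by apply: cvgZ; [exact: cw|apply: cvgB; [exact: cq|exact: cp]].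
have cE : continuous E.
  have c1 := segc _ _ _ (chart_arc b u cb cu bV u01) (chart_arc d u cd cu dV u01) cs.
  have c2 := segc _ _ _ (chart_arc l s cl cs lV s01) (chart_arc e s ce cs eV s01) cu.
  have c3 := segc (fun _ => phi (b 0)) (fun _ => phi (b 1)) u (@cst_continuous _ _ _) (@cst_continuous _ _ _) cu.
  have c4 := segc (fun _ => phi (d 0)) (fun _ => phi (d 1)) u (@cst_continuous _ _ _) (@cst_continuous _ _ _) cu.
  have c5 := segc _ _ _ c3 c4 cs.
  move=> z; apply: cvgB; last exact: c5.
  by apply: cvgD; [exact: c1|exact: c2].
have z0 : 0 <= (0 : R) <= 1 by rewrite lexx ler01.
have z1 : 0 <= (1 : R) <= 1 by rewrite lexx ler01.
have EB z : ball (phi x) (3 * r) (E z).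
  have B1 : ball (phi x) r (phi (b (u z)) + s z *: (phi (d (u z)) - phi (b (u z)))).
    by apply: ball_convex => //; [have [] := bV _ (u01 z)|have [] := dV _ (u01 z)].
  have B2 : ball (phi x) r (phi (l (s z)) + u z *: (phi (e (s z)) - phi (l (s z)))).
    by apply: ball_convex => //; [have [] := lV _ (s01 z)|have [] := eV _ (s01 z)].
  have B3 : ball (phi x) r ((phi (b 0) + u z *: (phi (b 1) - phi (b 0))) +
     s z *: ((phi (d 0) + u z *: (phi (d 1) - phi (d 0))) -
           (phi (b 0) + u z *: (phi (b 1) - phi (b 0))))).
    apply: ball_convex => //; apply: ball_convex => //.
    - by have [] := bV _ z0.
    - by have [] := bV _ z1.
    - by have [] := dV _ z0.
    - by have [] := dV _ z1.
  move: B1 B2 B3; rewrite /E -!ball_normE /=.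
  set p1 := (_ + s z *: (phi (d (u z)) - _)); set p2 := (_ + u z *: (phi (e (s z)) - _)).
  set p3 := (_ + s z *: (_ - _)) => h1 h2 h3.
  have -> : phi x - (p1 + p2 - p3) = (phi x - p1) + (phi x - p2) - (phi x - p3).
    by apply/rowP => k; rewrite !mxE; ring.
  apply: le_lt_trans (ler_normB _ _) _.
  have := ler_normD (phi x - p1) (phi x - p2); lra.
have cl0 : clamp01 0 = 0 :> R by exact: clamp01_id.
have cl1 : clamp01 1 = 1 :> R by exact: clamp01_id.
have KV y : chart_ball phi x r y -> chart_inv phi (phi y) = y by move=> [Dy _]; exact: K.
exists (chart_inv phi \o E); split.
- exact: chart_inv_comp_continuous rd cE EB.
- move=> t; rewrite /= -[RHS](KV _ (bV _ (I01 t))); congr (chart_inv phi _).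
  rewrite /E /s /u /= cl0 !scale0r !addr0 -b0 -b1.
  by apply/rowP => k; rewrite !mxE; ring.
- move=> t; rewrite /= -[RHS](KV _ (dV _ (I01 t))); congr (chart_inv phi _).
  rewrite /E /s /u /= cl1 !scale1r -d0 -d1.
  by apply/rowP => k; rewrite !mxE; ring.
- move=> t; rewrite /= -[RHS](KV _ (lV _ (I01 t))); congr (chart_inv phi _).
  rewrite /E /s /u /= cl0 !scale0r !addr0 b0 d0.
  by apply/rowP => k; rewrite !mxE; ring.
- move=> t; rewrite /= -[RHS](KV _ (eV _ (I01 t))); congr (chart_inv phi _).
  rewrite /E /s /u /= cl1 !scale1r b1 d1.
  by apply/rowP => k; rewrite !mxE; ring.
Qed.

Hypothesis atlas : smooth_atlas A.
Variable W : set M.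
Hypotheses (n2 : (2 <= n)%N) (tW : thin_in (A := A) (n - 2) W).

Lemma arc_to_generic (V : set M) q : open V -> V q ->
  exists l : R -> M, [/\ continuous l, l 0 = q, ~ W (l 1) & forall s, V (l s)].
Proof.
move=> oV Vq; have [_ cov _] := atlas; have [phi Aphi Dq] := cov q.
have cphi := atlas_chart atlas Aphi; have [_ _ K _ _] := cphi.
have [r [rd rV]] := exists_round cphi Dq (open_nbhs_nbhs (conj oV Vq)).
have nn : (n - 2 < n)%N by lia.
have [z [Dz bz] Wz] := thin_in_avoid atlas nn tW (round_open rd)
  (ex_intro _ q (chart_ball_center rd)).
pose g (s : R) := phi q + clamp01 s *: (phi z - phi q).
have [_ _ r0 _] := rd.
have gb s : ball (phi q) r (g s).
  by apply: ball_convex => //; [rewrite clamp01_ge0 clamp01_le1|exact: ballxx].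
exists (chart_inv phi \o g); split.
- apply: (chart_inv_comp_continuous rd _ gb) => s; apply: cvgD; first exact: cvg_cst.
  by apply: scale_line_continuous; exact: clamp01_continuous.
- by rewrite /= /g clamp01_id ?lexx ?ler01 // scale0r addr0 K.
- by rewrite /= /g clamp01_id ?lexx ?ler01 // scale1r subrKC K.
- by move=> s; apply: rV; exact: chart_ball_inv.
Qed.

(** Lebesgue number by contradiction: bad subintervals of finer and finer subdivisions accumulate at
    some [t], and a chart ball about [gam t] contains the image of one of them. The radius [3 * r]
    leaves room for the Coons patch. *)
Lemma lebesgue_partition (gam : R -> M) : continuous gam ->
  exists N : nat, forall i, (i <= N)%N -> exists phi x r,
    [/\ A phi, 0 < r, round phi x (3 * r) &
     forall u, 0 <= u <= 1 -> chart_ball phi x r (gam ((i%:R + u) / N.+1%:R))].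
Proof.
move=> cg; have [_ cov _] := atlas; apply: contrapT => /forallNP h.
pose bad N i := ~ exists phi x r,
    [/\ A phi, 0 < r, round phi x (3 * r) &
     forall u, 0 <= u <= 1 -> chart_ball phi x r (gam ((i%:R + u) / N.+1%:R))].
have /choice[z Hz] : forall N, exists i, (i <= N)%N /\ bad N i.
  move=> N; apply: contrapT => h'; apply: (h N) => i iN.
  by apply: contrapT => b; apply: h'; exists i.
have Kz N : `[0, 1]%classic ((z N)%:R / N.+1%:R : R).
  have [zN _] := Hz N; rewrite /= in_itv /= divr_ge0 //= ler_pdivrMr ?ltr0n // mul1r ler_nat.
  exact: leqW.
have [t _ clt] := compact_accumulation (segment_compact (a := 0) (b := 1)) Kz.
have [phi Aphi Dt] := cov (gam t); have cphi := atlas_chart atlas Aphi.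
have [r [rd _]] := exists_round cphi Dt filterT; have [_ _ r0 _] := rd.
have r30 : 0 < r / 3 by rewrite divr_gt0.
have rd3 : round phi (gam t) (r / 3) by apply: round_le rd r30 _; lra.
have nV : nbhs t (gam @^-1` chart_ball phi (gam t) (r / 3)).
  apply: cg; apply: open_nbhs_nbhs; split; first exact: round_open.
  exact: chart_ball_center.
have [e /= e0 He] := (nbhs_ballP _ _).1 nV.
have e20 : 0 < e / 2 by rewrite divr_gt0.
have [N mN bN] := clt _ (Num.bound (2 / e)) (nbhsx_ballx t _ e20).
have [_] := Hz N; apply; exists phi, (gam t), (r / 3); split=> //.
  by rewrite mulrCA mulfV ?mulr1 // pnatr_eq0.
move=> u /andP[u0 u1]; apply: He; move: bN; rewrite -!ball_normE /= mulrDl => bN.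
have N0 : 0 < N.+1%:R :> R by rewrite ltr0n.
have Ne : N.+1%:R^-1 < e / 2.
  rewrite -[N.+1%:R^-1]mul1r ltr_pdivrMr //.
  have : 2 / e < N.+1%:R.
    by apply: lt_trans (unstable.ltr_bound _) _; rewrite ltr_nat.
  rewrite ltr_pdivrMr // => h2; lra.
have uN : `|u / N.+1%:R| < e / 2.
  rewrite ger0_norm ?divr_ge0 //; apply: le_lt_trans Ne.
  by rewrite ler_pdivrMr // mulVf // gt_eqF.
rewrite opprD addrA; apply: le_lt_trans (ler_normB _ _) _; lra.
Qed.

Lemma ribbon (gam : R -> M) : continuous gam -> gam 0 = gam 1 ->
  exists (H : R * R -> M) (l : R -> M), [/\ continuous H, continuous l,
    forall t, 0 <= t <= 1 -> H (t, 0) = gam t,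
    forall t, 0 <= t <= 1 -> ~ W (H (t, 1)) &
    forall s, H (0, s) = l (clamp01 s) /\ H (1, s) = l (clamp01 s)].
Proof.
move=> cg g01; have [N HN] := lebesgue_partition cg.
have N0 : N.+1%:R != 0 :> R by rewrite pnatr_eq0.
have z0 : 0 <= (0 : R) <= 1 by rewrite lexx ler01.
have z1 : 0 <= (1 : R) <= 1 by rewrite lexx ler01.
pose g t := gam (t / N.+1%:R).
have cg' : continuous g.
  move=> t; apply: (@continuous_comp R R M (fun t : R => t / N.+1%:R) gam); last exact: cg.
  by apply: cvgM; [exact: cvg_id|exact: cvg_cst].
have shiftc i : continuous (fun u : R => g (i%:R + u)).
  move=> t; apply: (@continuous_comp _ _ _ (fun u : R => i%:R + u) g); last exact: cg'.
  by apply: cvgD; [exact: cvg_cst|exact: cvg_id].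
have /choice[D HD] : forall i, exists d : chart R M n * M * R, (i <= N)%N ->
    [/\ A d.1.1, 0 < d.2, round d.1.1 d.1.2 (3 * d.2) &
     forall u, 0 <= u <= 1 -> chart_ball d.1.1 d.1.2 d.2 (g (i%:R + u))].
  move=> i; have [iN|Ni] := pselect (i <= N)%N; last by exists (Chart setT (fun=> 0) (fun=> gam 0), gam 0, 0).
  by have [phi [x [r h]]] := HN i iN; exists (phi, x, r).
pose V i := chart_ball (D i).1.1 (D i).1.2 (D i).2.
have rdV i : (i <= N)%N -> round (D i).1.1 (D i).1.2 (D i).2.
  move=> iN; have [_ rp h _] := HD i iN; apply: (round_le h rp).
  by apply: ler_peMl; [exact: ltW|rewrite ler1n].
have VE i u : (i <= N)%N -> 0 <= u <= 1 -> V i (g (i%:R + u)).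
  by move=> /HD[_ _ _]; apply.
(* The arc at the base point must lie in the first and in the last ball: it bounds the ribbon on
   both sides, which makes the top edge a loop. *)
have [||l [cl l0 l1 lV]] := arc_to_generic (V := V 0%N `&` V N) (q := g 0).
- by apply: openI; apply: round_open; apply: rdV.
- split; first by have := VE 0%N 0 isT z0; rewrite addr0.
  have := VE N 1 (leqnn N) z1; rewrite natr1 /g divff // mul0r -g01; exact.
have cell i (l' e : R -> M) : (i <= N)%N -> continuous l' -> continuous e ->
    l' 0 = g i%:R -> e 0 = g (i%:R + 1) -> ~ W (l' 1) -> ~ W (e 1) ->
    (forall s, V i (l' s)) -> (forall s, V i (e s)) ->
    exists G : R * R -> M, [/\ continuous G,
      forall u, 0 <= u <= 1 -> G (u, 0) = g (i%:R + u),
      forall u, ~ W (G (u, 1)),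
      forall s, G (0, s) = l' (clamp01 s) & forall s, G (1, s) = e (clamp01 s)].
  move=> iN cl' ce l'0 e0 l'1 e1 l'V eV; have [Ai rp rd _] := HD i iN.
  have [d [cd d0 d1 dV]] := path_avoiding Ai (rdV i iN) n2 tW (l'V 1) l'1 (eV 1) e1.
  have [||||G [cG Gb Gt Gl Gr]] := coons_patch (b := fun u => g (i%:R + u)) (d := d) (l := l') (e := e) rd rp
    (shiftc i) cd cl' ce (fun u u01 => VE i u iN u01) (fun u _ => (dV u).1) (fun s _ => l'V s) (fun s _ => eV s).
  - by rewrite addr0 l'0.
  - by rewrite e0.
  - by [].
  - by [].
  exists G; split=> // [u u01|u]; first by rewrite Gb clamp01_id.
  by rewrite Gt; have [] := dV (clamp01 u).
(* The right edge [e] is universally quantified, so that the next cell can choose it in the overlap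
   of two consecutive balls. *)
have fill i : (i <= N)%N -> forall e : R -> M, continuous e -> e 0 = g (i%:R + 1) -> ~ W (e 1) ->
    (forall s, V i (e s)) ->
    exists H : R * R -> M, [/\ continuous H,
      forall t, 0 <= t <= i%:R + 1 -> H (t, 0) = g t,
      forall t, 0 <= t <= i%:R + 1 -> ~ W (H (t, 1)),
      forall s, H (0, s) = l (clamp01 s) &
      forall s, H (i%:R + 1, s) = e (clamp01 s)].
  elim: i => [|i IH] iN e ce e0 e1 eV.
    have [G [cG Gb Gt Gl Gr]] := cell 0%N l e iN cl ce l0 e0 l1 e1 (fun s => (lV s).1) eV.
    exists G; split=> // [t|s]; rewrite add0r //.
    by move=> t01; rewrite Gb // add0r.
  have iN' : (i <= N)%N by exact: ltnW.
  have [||e' [ce' e'0 e'1 e'V]] := arc_to_generic (V := V i `&` V i.+1) (q := g (i%:R + 1)).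
  - by apply: openI; apply: round_open; apply: rdV.
  - split; first exact: VE.
    by have := VE i.+1 0 iN z0; rewrite addr0 -natr1.
  have [H [cH Hb Ht Hl Hr]] := IH iN' e' ce' e'0 e'1 (fun s => (e'V s).1).
  have e'0' : e' 0 = g i.+1%:R by rewrite e'0 natr1.
  have [G [cG Gb Gt Gl Gr]] := cell i.+1 e' e iN ce' ce e'0' e0 e'1 e1 (fun s => (e'V s).2) eV.
  pose h (z : R * R) := z.1 - i.+1%:R.
  have ch : continuous h by move=> z; apply: cvgB; [exact: cvg_fst|exact: cvg_cst].
  have cG' : continuous (fun z : R * R => G (h z, z.2)).
    move=> z; apply: (@continuous_comp _ _ _ (fun z => (h z, z.2)) G); last exact: cG.
    by apply: (pair_continuous ch) => y; exact: cvg_snd.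
  exists (fun z => if h z <= 0 then H z else G (h z, z.2)); split.
  - apply: glue_continuous => //; move=> [t s] /= hz.
    have -> : t = i%:R + 1 by move: hz; rewrite /h /= -natr1; lra.
    by rewrite Hr /h /= natr1 subrr Gl.
  - move=> t /andP[t0 t1]; rewrite /h /=; case: ifP => ht.
      by rewrite Hb //; apply/andP; split=> //; rewrite natr1 -subr_le0.
    rewrite Gb; first by congr g; ring.
    move: ht => /negbT; rewrite -ltNge => ht; apply/andP; split; [exact: ltW|lra].
  - move=> t /andP[t0 t1]; rewrite /h /=; case: ifP => ht; last exact: Gt.
    by apply: Ht; apply/andP; split=> //; rewrite natr1 -subr_le0.
  - by move=> s; rewrite /h /= sub0r oppr_le0 ler0n.
  - move=> s; rewrite /h /= [i.+1%:R + 1]addrC addrK ler10 /=; exact: Gr.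
have gN : g (N%:R + 1) = g 0 by rewrite /g natr1 divff // mul0r.
have [H [cH Hb Ht Hl Hr]] := fill N (leqnn N) l cl (etrans l0 (esym gN)) l1 (fun s => (lV s).2).
exists (fun z => H (N.+1%:R * z.1, z.2)), l; split=> //.
- move=> z; apply: (@continuous_comp _ _ _ (fun z : R * R => (N.+1%:R * z.1, z.2)) H); last exact: cH.
  apply: pair_continuous => y; last exact: cvg_snd.
  by apply: cvgM; [exact: cvg_cst|exact: cvg_fst].
- move=> t /andP[t0 t1]; rewrite /= Hb; first by rewrite /g mulrC mulKf.
  by rewrite mulr_ge0 //= natr1 ger_pMr // ltr0n.
- move=> t /andP[t0 t1]; rewrite /=; apply: Ht.
  by rewrite mulr_ge0 //= natr1 ger_pMr // ltr0n.
- by move=> s; rewrite /= mulr0 Hl mulr1 -natr1 Hr.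
Qed.

End Cells.

(** * Path connectedness of connected manifolds *)

Section PathConnectedness.
Context {R : realType} {M : topologicalType} {n : nat} {A : set (chart R M n)}.

Let joined (x y : M) := exists gam : R -> M, [/\ continuous gam, gam 0 = x & gam 1 = y].

Lemma joined_sym x y : joined x y -> joined y x.
Proof.
move=> [gam [cg g0 g1]]; exists (fun t => gam (1 - t)); rewrite subr0 subrr; split=> // t.
apply: (@continuous_comp R R M (fun t : R => 1 - t) gam); last exact: cg.
by apply: cvgB; [exact: cvg_cst|exact: cvg_id].
Qed.

Lemma joined_trans x y z : joined x y -> joined y z -> joined x z.
Proof.
move=> [a [ca a0 a1]] [b [cb b0 b1]].
have cl : continuous (fun t : R => 2 * t) by move=> t; apply: cvgM; [exact: cvg_cst|exact: cvg_id].
have cl' : continuous (fun t : R => 2 * t - 1).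
  by move=> t; apply: cvgB; [exact: cl|exact: cvg_cst].
exists (fun t => if 2 * t - 1 <= 0 then a (2 * t) else b (2 * t - 1)); split.
- apply: (glue_continuous cl') => [t|t|t /eqP].
  + by apply: (@continuous_comp R R M (fun t : R => 2 * t) a); [exact: cl|exact: ca].
  + by apply: (@continuous_comp R R M (fun t : R => 2 * t - 1) b); [exact: cl'|exact: cb].
  + by rewrite subr_eq0 => /eqP ->; rewrite a1 subrr b0.
- by rewrite mulr0 sub0r lerN10 a0.
- have -> : 2 * 1 - 1 = 1 :> R by ring.
  by rewrite ler10.
Qed.

Lemma chart_ball_joined (phi : chart R M n) x r y : round phi x r ->
  chart_ball phi x r y -> joined x y.
Proof.
move=> rd [Dy by_]; have [[_ _ K _ _] Dx r0 _] := rd.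
exists (chart_inv phi \o (fun s : R => phi x + clamp01 s *: (phi y - phi x))); split.
- apply: (chart_inv_comp_continuous rd) => [s|s].
    apply: cvgD; first exact: cvg_cst.
    by apply: scale_line_continuous; exact: clamp01_continuous.
  by apply: ball_convex => //; [rewrite clamp01_ge0 clamp01_le1|exact: ballxx].
- by rewrite /= clamp01_id ?lexx ?ler01 // scale0r addr0 K.
- by rewrite /= clamp01_id ?lexx ?ler01 // scale1r subrKC K.
Qed.

Lemma connected_path_connected : smooth_atlas A -> connected [set: M] -> path_connected R M.
Proof.
move=> atlas cM I01 x y; have [_ cov _] := atlas.
have loc z : exists V : set M, [/\ open V, V z & forall w, V w -> joined z w].
  have [phi Aphi Dz] := cov z.
  have [r [rd _]] := exists_round (atlas_chart atlas Aphi) Dz filterT.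
  exists (chart_ball phi z r); split; [exact: round_open|exact: chart_ball_center|].
  by move=> w; exact: chart_ball_joined.
suff E : [set z | joined x z] = setT.
  have [gam [cg g0 g1]] : joined x y by rewrite -[joined x y]/([set z | joined x z] y) E.
  by exists gam; split=> //; exact: continuous_subspaceT.
have refl : joined x x by exists (fun=> x); split=> //; exact: cst_continuous.
apply: cM; first by exists x.
- exists [set z | joined x z]; rewrite ?setTI // openE => z Jz.
  have [V [oV Vz JV]] := loc z.
  by apply: filterS (open_nbhs_nbhs (conj oV Vz)) => w /JV; exact: joined_trans.
- exists [set z | joined x z]; rewrite ?setTI // -openC openE => z Jz.
  have [V [oV Vz JV]] := loc z.
  apply: filterS (open_nbhs_nbhs (conj oV Vz)) => w /JV Jzw Jxw; apply: Jz.
  exact: joined_trans Jxw (joined_sym Jzw).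
Qed.

End PathConnectedness.

(** * Contracting loops through a basin *)

Section NullHomotopy.
Context {R : realType} {M : topologicalType} {n : nat} {A : set (chart R M n)}.
Hypothesis atlas : smooth_atlas A.

(** [S] is forward invariant, so an orbit that enters it remains there, and compactness gives one
    [k] for the whole loop. The straight contraction in the chart is carried back by [k] iterates of
    the inverse. *)
Lemma basin_null_homotopy (f : diffeo A) p (d : R -> M) : attractor f p -> continuous d ->
  d 0 = d 1 -> (forall t, 0 <= t <= 1 -> Ws f p (d t)) ->
  exists T : R * R -> M, [/\ continuous T,
    forall t, T (t, 0) = d (clamp01 t), forall t, T (t, 1) = d 0 &
    forall s, T (0, s) = d 0 /\ T (1, s) = d 0].
Proof.
move=> [fp at_p] cd d01 dW; have [_ cov _] := atlas; have [phi Aphi Dp] := cov p.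
have cf : continuous f := (diffeo_smooth f).1.
have cg : continuous (diffeo_inv f) := (diffeo_inv_smooth f).1.
have [r [rd _]] := exists_round (atlas_chart atlas Aphi) Dp filterT.
have [[_ _ K _ _] _ _ _] := rd.
have nV : nbhs p (chart_ball phi p r).
  by apply: open_nbhs_nbhs; split; [exact: round_open|exact: chart_ball_center].
have [S [oS Sp SV Sf _]] := at_p _ nV.
have mono k i x : (k <= i)%N -> S (iter k f x) -> S (iter i f x).
  move=> ki Sk; rewrite -(subnK ki); elim: (i - k)%N => [//|j IH].
  by apply: Sf; exists (iter (j + k) f x).
have [k Hk] : exists k, forall t, 0 <= t <= 1 -> S (iter k f (d t)).
  apply: contrapT => /forallNP h.
  have /choice[z Hz] : forall k, exists t, 0 <= t <= 1 /\ ~ S (iter k f (d t)).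
    move=> k; apply: contrapT => h'; apply: (h k) => t t01.
    by apply: contrapT => nS; apply: h'; exists t.
  have Kz i : `[0, 1]%classic (z i) by rewrite /= in_itv /=; have [] := Hz i.
  have [t It clt] := compact_accumulation (segment_compact (a := 0) (b := 1)) Kz.
  have t01 : 0 <= t <= 1 by move: It; rewrite /= in_itv.
  have [m _ Hm] := dW t t01 S (open_nbhs_nbhs (conj oS Sp)).
  have nt : nbhs t ((iter m f \o d) @^-1` S).
    apply: (@continuous_comp R M M d (iter m f)); [exact: cd|exact: iter_continuous|].
    by apply: open_nbhs_nbhs; split=> //; exact: (Hm m (leqnn m)).
  have [i mi Si] := clt _ m nt; have [_] := Hz i; apply.
  exact: mono mi Si.
have gK j x : iter j (diffeo_inv f) (iter j f x) = x.
  by elim: j => // j IH; rewrite iterSr iterS diffeo_funK.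
have I01 (t : R) : 0 <= clamp01 t <= 1 by rewrite clamp01_ge0 clamp01_le1.
pose a (t : R) := phi (iter k f (d (clamp01 t))).
have z0 : 0 <= (0 : R) <= 1 by rewrite lexx ler01.
have z1 : 0 <= (1 : R) <= 1 by rewrite lexx ler01.
have ca : continuous a.
  have c : continuous (fun t => iter k f (d (clamp01 t))).
    move=> t; apply: (@continuous_comp R M M (fun t => d (clamp01 t)) (iter k f)).
      by apply: (@continuous_comp R R M clamp01 d); [exact: clamp01_continuous|exact: cd].
    exact: iter_continuous.
  apply: (chart_ball_continuous rd c) => t.
  by have [] := SV _ (Hk _ (I01 t)).
have ab t : ball (phi p) r (a t) by have [] := SV _ (Hk _ (I01 t)).
pose E (z : R * R) := a z.1 + clamp01 z.2 *: (a 0 - a z.1).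
have cE : continuous E.
  have c1 : continuous (fun z : R * R => a z.1).
    move=> z; apply: (@continuous_comp _ R _ (fun z : R * R => z.1) a); [exact: cvg_fst|exact: ca].
  have c2 : continuous (fun z : R * R => clamp01 z.2).
    by apply: comp_clamp01_continuous => z; exact: cvg_snd.
  move=> z; apply: cvgD; first exact: c1.
  by apply: cvgZ; [exact: c2|apply: cvgB; [exact: cvg_cst|exact: c1]].
have EB z : ball (phi p) r (E z) by apply: ball_convex.
have aK t : iter k (diffeo_inv f) (chart_inv phi (a t)) = d (clamp01 t).
  by rewrite /a K; [exact: gK|have [] := SV _ (Hk _ (I01 t))].
exists (iter k (diffeo_inv f) \o (chart_inv phi \o E)); split.
- move=> z; apply: (@continuous_comp _ M M (chart_inv phi \o E) (iter k (diffeo_inv f))).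
    exact: chart_inv_comp_continuous rd cE EB _.
  exact: iter_continuous.
- by move=> t; rewrite /= /E /= (clamp01_id z0) scale0r addr0 aK.
- by move=> t; rewrite /= /E /= (clamp01_id z1) scale1r subrKC aK (clamp01_id z0).
- have a1 : a 1 = a 0 by rewrite /a (clamp01_id z0) (clamp01_id z1) d01.
  move=> s; rewrite /= /E /= a1 subrr scaler0 addr0 aK (clamp01_id z0).
  by [].
Qed.

(* Slides a loop up a rectangle whose sides carry the same arc and whose top is
   constant, then retracts it down that arc. *)
Lemma rectangle_null_homotopic (gam : R -> M) (G : R * R -> M) (l : R -> M) :
  continuous G -> continuous l -> (forall t, 0 <= t <= 1 -> G (t, 0) = gam t) ->
  (forall t, 0 <= t <= 1 -> G (t, 1) = l 1) ->
  (forall s, 0 <= s <= 1 -> G (0, s) = l s /\ G (1, s) = l s) ->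
  null_homotopic_loop gam.
Proof.
move=> cG cl G0 G1 Gs.
have z0 : 0 <= (0 : R) <= 1 by rewrite lexx ler01.
have z1 : 0 <= (1 : R) <= 1 by rewrite lexx ler01.
have I01 (t : R) : 0 <= clamp01 t <= 1 by rewrite clamp01_ge0 clamp01_le1.
(* In three equal times, [(X, Y)] runs up the left side, along the top and down the right side; [G]
   along it is [l (Y t)]. *)
pose Y (t : R) := clamp01 (Num.min (3 * t) (3 - 3 * t)).
pose X (t : R) := clamp01 (3 * t - 1).
have c3 : continuous (fun t : R => 3 * t) by move=> t; apply: cvgM; [exact: cvg_cst|exact: cvg_id].
have cX : continuous X.
  by apply: comp_clamp01_continuous => t; apply: cvgB; [exact: c3|exact: cvg_cst].
have cY : continuous Y.
  apply: comp_clamp01_continuous => t.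
  apply: (@continuous_min R R (fun t : R => 3 * t) (fun t : R => 3 - 3 * t)); first exact: c3.
  by apply: cvgB; [exact: cvg_cst|exact: c3].
have Y01 t : 0 <= Y t <= 1 by exact: I01.
have XY t : G (X t, Y t) = l (Y t).
  have [th|th] := leP (3 * t) 1.
    have -> : X t = 0.
      by rewrite /X /clamp01 min_l ?max_l //; lra.
    by have [] := Gs _ (Y01 t).
  have [th2|th2] := leP (3 * t) 2; last first.
    have -> : X t = 1.
      by rewrite /X /clamp01 min_r ?max_r //; lra.
    by have [] := Gs _ (Y01 t).
  have -> : Y t = 1.
    by rewrite /Y /clamp01 [Num.min _ 1]min_r ?max_r // le_min; apply/andP; split; lra.
  by rewrite G1 // I01.
have Y0 : Y 0 = 0.
  by rewrite /Y /clamp01 mulr0 subr0 [Num.min 0 3]min_l ?min_l ?max_l.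
have Y1 : Y 1 = 0.
  by rewrite /Y /clamp01 mulr1 subrr [Num.min 3 0]min_r ?min_l ?max_l.
have X0 : X 0 = 0 by rewrite /X /clamp01 mulr0 sub0r min_l ?max_l //; lra.
have X1 : X 1 = 1 by rewrite /X /clamp01 mulr1 min_r ?max_r //; lra.
pose u (z : R * R) := clamp01 (2 * z.1).
(* During the first half [(P, Q)] moves the bottom edge to the three-sided path, fixing the corners;
   during the second half [b] lowers the cap on the height along [l] from 1 to 0. *)
pose P (z : R * R) := clamp01 z.2 + u z * (X z.2 - clamp01 z.2).
pose Q (z : R * R) := Num.min (u z) (Y z.2).
pose a z := G (P z, Q z).
pose b (z : R * R) := l (Num.min (clamp01 (2 - 2 * z.1)) (Y z.2)).
have comp1 (g : R -> R) : continuous g -> continuous (fun z : R * R => g z.1).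
  move=> cg z; apply: (@continuous_comp _ R R (fun z : R * R => z.1) g); [exact: cvg_fst|exact: cg].
have comp2 (g : R -> R) : continuous g -> continuous (fun z : R * R => g z.2).
  move=> cg z; apply: (@continuous_comp _ R R (fun z : R * R => z.2) g); [exact: cvg_snd|exact: cg].
have c2 : continuous (fun t : R => 2 * t) by move=> t; apply: cvgM; [exact: cvg_cst|exact: cvg_id].
have cu : continuous u.
  by apply: comp_clamp01_continuous; exact: (comp1 _ c2).
have cP : continuous P.
  move=> z; apply: cvgD; first exact: (comp2 _ clamp01_continuous).
  apply: cvgM; first exact: cu.
  by apply: cvgB; [exact: (comp2 _ cX)|exact: (comp2 _ clamp01_continuous)].
have cQ : continuous Q.
  move=> z; apply: (@continuous_min R _ u (fun z => Y z.2)); [exact: cu|exact: (comp2 _ cY)].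
have ca : continuous a.
  move=> z; apply: (@continuous_comp _ _ _ (fun z => (P z, Q z)) G); last exact: cG.
  exact: pair_continuous.
have cb : continuous b.
  move=> z; apply: (@continuous_comp _ R M (fun z : R * R => Num.min (clamp01 (2 - 2 * z.1)) (Y z.2)) l).
    apply: (@continuous_min R _ (fun z : R * R => clamp01 (2 - 2 * z.1)) (fun z => Y z.2)).
      apply: comp_clamp01_continuous => w; apply: cvgB; [exact: cvg_cst|exact: (comp1 _ c2)].
    exact: (comp2 _ cY).
  exact: cl.
pose h (z : R * R) := 2 * z.1 - 1.
have ch : continuous h by move=> z; apply: cvgB; [exact: (comp1 _ c2)|exact: cvg_cst].
have l0 : l 0 = gam 0 by have [<- _] := Gs 0 z0; rewrite G0.
have l0' : gam 1 = gam 0 by rewrite -l0 -G0 //; have [_ ->] := Gs 0 z0.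
exists (fun z => if h z <= 0 then a z else b z); split.
- apply: continuous_subspaceT; apply: glue_continuous => // -[s t]; rewrite /h /= => hs.
  have hs2 : 2 * s = 1 by lra.
  rewrite /a /b /P /Q /u /= hs2 (clamp01_id z1) mul1r subrKC.
  have -> : clamp01 (2 - 1) = 1 :> R.
    have -> : 2 - 1 = 1 :> R by ring.
    exact: clamp01_id.
  have /andP[_ Yt1] := Y01 t.
  by rewrite min_r // XY.
- move=> t; rewrite /= in_itv /= => t01.
  rewrite /h /= mulr0 sub0r lerN10 /a /P /Q /u /= mulr0 (clamp01_id z0) mul0r addr0.
  have /andP[Yt0 _] := Y01 t.
  by rewrite min_l // (clamp01_id t01) G0.
- move=> t; rewrite /= in_itv /= => t01.
  have /andP[Yt0 _] := Y01 t.
  rewrite /h /= mulr1 [2 - 1 <= 0](_ : _ = false); last by apply/negbTE; rewrite -ltNge; lra.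
  by rewrite /b /= mulr1 subrr (clamp01_id z0) min_l.
- move=> s; rewrite /= in_itv /= => s01.
  have /andP[us0 us1] : 0 <= u (s, 0) <= 1 by exact: I01.
  have /andP[vs0 vs1] : 0 <= u (s, 1) <= 1 by exact: I01.
  have /andP[ws0 _] := I01 (2 - 2 * s).
  split; case: ifP => _.
  + by rewrite /a /P /Q /= Y0 X0 (clamp01_id z0) subrr mulr0 addr0 min_r // G0.
  + by rewrite /b /= Y0 min_r.
  + rewrite /a /P /Q /= Y1 X1 (clamp01_id z1) subrr mulr0 addr0 min_r // G0 //.
  + by rewrite /b /= Y1 min_r.
Qed.

Lemma generic_basin_simply_connected (f : diffeo A) p (W : set M) : (2 <= n)%N ->
  connected [set: M] -> attractor f p -> thin_in (A := A) (n - 2) W ->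
  (forall x, ~ W x -> Ws f p x) -> simply_connected R M.
Proof.
move=> n2 cM at_p tW WB; split; first exact: (connected_path_connected atlas).
move=> gam /within01_continuous cg g01.
have z0 : 0 <= (0 : R) <= 1 by rewrite lexx ler01.
have z1 : 0 <= (1 : R) <= 1 by rewrite lexx ler01.
have [|H [l [cH cl H0 H1 Hs]]] := ribbon atlas n2 tW cg.
  by rewrite (clamp01_id z0) (clamp01_id z1).
pose d (t : R) := H (clamp01 t, 1).
have I01 (t : R) : 0 <= clamp01 t <= 1 by rewrite clamp01_ge0 clamp01_le1.
have cd : continuous d.
  move=> t; apply: (@continuous_comp _ _ _ (fun t : R => (clamp01 t, 1 : R)) H); last exact: cH.
  by apply: pair_continuous; [exact: clamp01_continuous|exact: cst_continuous].
have d0 : d 0 = l 1 by rewrite /d (clamp01_id z0); have [-> _] := Hs 1; rewrite (clamp01_id z1).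
have d1 : d 1 = l 1 by rewrite /d (clamp01_id z1); have [_ ->] := Hs 1; rewrite (clamp01_id z1).
have [|t t01|T [cT T0 T1 Ts]] := basin_null_homotopy at_p cd.
- by rewrite d0 d1.
- by apply: WB; apply: H1.
pose h (z : R * R) := 2 * z.2 - 1.
have ch : continuous h.
  move=> z; apply: cvgB; last exact: cvg_cst.
  by apply: cvgM; [exact: cvg_cst|exact: cvg_snd].
(* The ribbon fills the lower half and the contraction of its top edge the upper half; both sides
   follow [l] and then rest at [l 1]. *)
pose G (z : R * R) := if h z <= 0 then H (clamp01 z.1, clamp01 (2 * z.2)) else T (z.1, h z).
pose l' (s : R) := l (clamp01 (2 * s)).
have c2 : continuous (fun z : R * R => 2 * z.2).
  by move=> z; apply: cvgM; [exact: cvg_cst|exact: cvg_snd].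
apply: (@rectangle_null_homotopic _ G l').
- apply: (glue_continuous ch).
  + move=> z; apply: (@continuous_comp _ _ _ (fun z : R * R => (clamp01 z.1, clamp01 (2 * z.2))) H); last exact: cH.
    apply: pair_continuous; first by apply: comp_clamp01_continuous => y; exact: cvg_fst.
    exact: comp_clamp01_continuous.
  + move=> z; apply: (@continuous_comp _ _ _ (fun z : R * R => (z.1, h z)) T); last exact: cT.
    by apply: pair_continuous => // y; exact: cvg_fst.
  + move=> [t s] /= hz; rewrite hz T0 /d [clamp01 (clamp01 t)]clamp01_id //.
    have -> : 2 * s = 1 by move: hz; rewrite /h /=; lra.
    by rewrite (clamp01_id z1).
- move=> s; apply: (@continuous_comp R R M (fun s : R => clamp01 (2 * s)) l); last exact: cl.
  apply: comp_clamp01_continuous => t; apply: cvgM; [exact: cvg_cst|exact: cvg_id].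
- move=> t t01; rewrite /G /h /= mulr0 sub0r lerN10 (clamp01_id z0) (clamp01_id t01).
  by rewrite H0 // (clamp01_id t01).
- move=> t t01; rewrite /G /h /= mulr1 [2 - 1 <= 0](_ : _ = false); last first.
    by apply/negbTE; rewrite -ltNge; lra.
  have -> : 2 - 1 = 1 :> R by ring.
  by rewrite T1 d0 /l' mulr1 /clamp01 min_r ?max_r //; lra.
- move=> s s01; rewrite /G /h /= /l'; case: ifP => hs.
    rewrite (clamp01_id z0) (clamp01_id z1); have [-> ->] := Hs (clamp01 (2 * s)).
    by rewrite [clamp01 (clamp01 _)]clamp01_id.
  have [-> ->] := Ts (2 * s - 1); rewrite d0.
  have -> : clamp01 (2 * s) = 1.
    move: hs => /negbT; rewrite -ltNge => hs.
    by rewrite /clamp01 min_r ?max_r //; lra.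
  by [].
Qed.

End NullHomotopy.

(** * Counting sinks and sources *)

Section MorseSmaleFixedPoints.
Context {R : realType} {M : topologicalType} {n : nat} {A : set (chart R M n)}.
Hypothesis closedM : closed_smooth_manifold A.

Lemma hyperbolic_adapted_pair (f : diffeo A) p : hyperbolic_fixed_point f p -> adapted_pair f p.
Proof.
move=> /(hyperbolic_adapted closedM)[phi [N [H [c [Aphi adf [c' adg]]]]]].
by exists phi, N, H, c, c'.
Qed.

Lemma nonwanderingV (f : diffeo A) x : nonwandering (diffeoV f) x -> nonwandering f x.
Proof.
move=> h U oU Ux; have [k k0 [y [[z Uz <-] Uy]]] := h U oU Ux; exists k => //.
exists z; split=> //; exists (iter k (diffeo_inv f) z) => //.
elim: k {k0 Uy} => [//|k IH]; rewrite iterSr /= diffeo_invK; exact: IH.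
Qed.

Lemma attractor_not_thin (f : diffeo A) p : (2 <= n)%N -> attractor f p ->
  ~ thin_in (A := A) (n - 2) (Ws f p).
Proof.
move=> n2 at_p tW; have [_ _ _ atlas] := closedM.
have nn : (n - 2 < n)%N by lia.
by have [x] := thin_in_avoid atlas nn tW (attractor_basin_open at_p)
  (ex_intro _ p (fixed_stable at_p.1)).
Qed.

Lemma card_singleton (T : Type) (S : set T) (p : T) k :
  (S #= `I_k)%card -> S = [set p] -> k = 1%N.
Proof.
move=> Sk Sp; rewrite Sp in Sk; apply/esym/card_eq_II.
by apply: card_eq_trans Sk; apply: card_esym; exact: card_set1.
Qed.

(** [sinks] is a parameter so that the statement serves both the sinks of a diffeomorphism and,
    through the inverse, its sources. *)
Lemma unique_sink (f : diffeo A) (sinks : set M) k : (2 <= n)%N -> connected [set: M] ->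
  [set: M] !=set0 -> finite_set (nonwandering f) ->
  (forall p, nonwandering f p -> sinks p \/ thin_in (A := A) (n - 2) (Ws f p)) ->
  (forall p, nonwandering f p -> f p = p) ->
  (forall p, sinks p -> attractor f p) -> (sinks #= `I_k)%card ->
  k = 1%N /\ exists p W, [/\ attractor f p, thin_in (A := A) (n - 2) W &
    forall x, ~ W x -> Ws f p x].
Proof.
move=> n2 cM [x0 _] fNW NWsinks fixNW sinksA sk.
have [|p [W [at_p tW WB uni]]] := unique_attractor closedM n2 x0 cM fNW.
  move=> p NWp; split; first exact: fixNW.
  by case: (NWsinks p NWp) => [/sinksA|]; [left|right].
split; last by exists p, W.
apply: (card_singleton sk (p := p)).
apply/seteqP; split=> [q /sinksA /uni //|_ ->].
have NWp : nonwandering f p.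
  by move=> U oU Up; exists 1%N => //; exists p; split=> //; exists p => //=; exact: at_p.1.
case: (NWsinks p NWp) => // /(attractor_not_thin n2 at_p) [].
Qed.

End MorseSmaleFixedPoints.

Theorem theorem4 (R : realType) (n : nat) (M : topologicalType)
    (A : set (chart R M n)) (a b c : nat) (f : diffeo A)
    (n_ge4 : (4 <= n)%N) (c_ge1 : (1 <= c)%N)
    (M_closed : closed_smooth_manifold A)
    (M_connected : connected [set: M])
    (f_MS : MS a b c f)
    (f_no_codim1 : forall p : M, ~ codimension_one_saddle f p) :
  a = 1%N /\ b = 1%N /\ simply_connected R M.
Proof.
have n2 : (2 <= n)%N by lia.
have [_ _ _ atlas] := M_closed.
case: f_MS => -[_ fNW _] NWE [card_sink card_source card_saddle] orient.
have hyp p : nonwandering f p -> hyperbolic_fixed_point f p.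
  by rewrite NWE => -[[[]|[]]|[]].
have ap p : nonwandering f p -> adapted_pair f p.
  by move=> /hyp; exact: hyperbolic_adapted_pair.
have sinkA p : sink f p -> attractor f p /\ Wu f p = [set p].
  by move=> [hp dp]; apply: attractor_of_dim => //; exact: hyperbolic_adapted_pair.
have sourceA p : source f p -> attractor (diffeoV f) p /\ Ws f p = [set p].
  move=> [hp dp]; have := hyperbolic_adapted_pair M_closed hp => /adapted_pairV apV.
  exact: (attractor_of_dim M_closed apV dp).
have saddleT p : saddle f p ->
    thin_in (A := A) (n - 2) (Ws f p) /\ thin_in (A := A) (n - 2) (Wu f p).
  (* [saddle] parametrizes only the unstable manifold; the dimension of the stable one is read off
     the parametrization inside [orientation_preserving_on]. *)
  move=> sp; have [[k [j [G [ij _ _ _]]]] _] := orient p sp.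
  apply: (saddle_thin (k := k) M_closed n2) => //; last by exists j.
  by apply: hyperbolic_adapted_pair => //; case: sp.
(* The empty space counts as connected; a saddle provides a point. *)
have M0 : [set: M] !=set0.
  have [p sp] : saddle f !=set0.
    apply/set0P/eqP => s0; move: card_saddle; rewrite s0 => /card_esym.
    rewrite card_eq0 => /eqP c0; have : `I_c 0%N by exact: c_ge1.
    by rewrite c0.
  by exists p.
have [|||a1 [p [W [at_p tW WB]]]] := unique_sink M_closed (f := f) n2 M_connected M0 fNW _ _ _ card_sink.
- move=> p; rewrite NWE => -[[sp|/sourceA[_ ->]]|/saddleT[]]; [by left|right|by right].
  exact: thin_in1.
- by move=> p /hyp [].
- by move=> p /sinkA [].
(* Sources of [f] are attractors of the inverse, whose stable sets are the unstable sets of [f]. *)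
have [||||b1 _] := unique_sink M_closed (f := diffeoV f) n2 M_connected M0 _ _ _ _ card_source.
- by apply: sub_finite_set fNW => q; exact: nonwanderingV.
- move=> q /nonwanderingV; rewrite NWE => -[[/sinkA[_ e]|sp]|/saddleT[_ tp]]; [right|by left|by right].
  have -> : Ws (diffeoV f) q = [set q] by exact: e.
  exact: thin_in1.
- by move=> q /nonwanderingV /hyp [fp _]; rewrite /= -{1}fp diffeo_funK.
- by move=> q /sourceA [].
split=> //; split=> //.
exact: (generic_basin_simply_connected atlas n2 M_connected at_p tW WB).
Qed.
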